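(* Let $F$ be a finite extension of $\mathbb{Q}_p$, $s\in G_{(q-1)}$ and $u\in\mathcal{H}(\mathcal{O}_FG)$. Let $h$ be the homomorphism associated to $u\,\Theta^t_*(f_s)\in\mathcal{H}(FG)$. Then $h$ factors through $\Omega_F^t$ with $h(\sigma)=s$, and there exists $a\in F_h$ with $A_h=\mathcal{O}_FG\cdot a$ and $\mathbf{r}_G(a)G=u\,\Theta^t_*(f_s)$.
   Context: $G$ is a finite abelian group of odd order. $F^c$ is an algebraic closure of $F$, $\Omega_F=\mathrm{Gal}(F^c/F)$ acts trivially on $G$; homomorphisms are continuous. For $h\in\mathrm{Hom}(\Omega_F,G)$: $F_h$ is the set of maps $a:G\to F^c$ with $\omega(a(s))=a(h(\omega)s)$, $G$ acting by $(s\cdot a)(t)=a(ts)$; $F^h$ is the fixed field of $\ker h$; $A^h$ is the fractional ideal of $\mathcal{O}_{F^h}$ whose square is the inverse different of $F^h/F$; $A_h=\{a\in F_h:a(s)\in A^h\ \forall s\}$. Resolvend $\mathbf{r}_G(a)=\sum_s a(s)s^{-1}\in F^cG$; $\Omega_F$ acts on $F^cG$ through coefficients; $\mathcal{H}(FG)=((F^cG)^\times/G)^{\Omega_F}$, $\mathcal{H}(\mathcal{O}_FG)=((\mathcal{O}_{F^c}G)^\times/G)^{\Omega_F}$. The homomorphism associated to $xG\in\mathcal{H}(FG)$ ($x\in(F^cG)^\times$) is $\omega\mapsto x^{-1}(\omega\cdot x)\in G$. Tame data: $\pi$ a fixed uniformizer of $F$, $q$ the residue field size, $F^{nr}\subset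 F^t$ the maximal unramified and maximal tame extensions, $\Omega_F^t=\mathrm{Gal}(F^t/F)$. Fix primitive roots of unity $\zeta_n$ with $\zeta_{mn}^m=\zeta_n$ and radicals $\pi^{1/n}$ ($(n,p)=1$) with $(\pi^{1/mn})^m=\pi^{1/n}$; $\sigma\in\Omega^t_F$ fixes $F^{nr}$ and $\sigma(\pi^{1/n})=\zeta_n\pi^{1/n}$. $G_{(q-1)}$ is the set of elements of $G$ of order dividing $q-1$. Stickelberger data: $\hat G=\mathrm{Hom}(G,(F^c)^\times)$; identify $(F^cG)^\times$ with $\mathrm{Hom}(\mathbb{Z}\hat G,(F^c)^\times)$ via $\sum x_tt\mapsto(\chi\mapsto\sum x_t\chi(t))$ extended linearly; $A_{\hat G}=\{\sum n_\chi\chi:\prod\chi^{n_\chi}=1\}$, and restriction to $A_{\hat G}$ identifies $\mathcal{H}(FG)$ with $\mathrm{Hom}_{\Omega_F}(A_{\hat G},(F^c)^\times)$. $\langle\chi,s\rangle_*=\upsilon/|s|$ where $\upsilon$ is the integer in $[\frac{1-|s|}2,\frac{|s|-1}2]$ with $\chi(s)=\zeta_{|s|}^\upsilon$, extended linearly (integer-valued on $A_{\hat G}$). $G(-1)$ is $G$ with $\omega\cdot s=s^{\kappa(\omega)^{-1}}$, $\kappa$ the $\exp(G)$-th cyclotomic character; $\Lambda(FG)^\times$ is the group of $\Omega_F$-equivariant maps $G(-1)\to(F^c)^\times$; $\Theta^t_*(g)(\psi)=\prod_s g(s)^{\langle\psi,s\rangle_*}$. $f_s\in\Lambda(FG)^\times$: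 $f_s(t)=\pi$ if $t=s\neq1$, else $1$. *)

(* Defs.v *)
From HB Require Import structures.
From mathcomp Require Import all_boot all_order all_algebra all_fingroup all_solvable all_field.
From mathcomp Require Import all_classical.
From mathcomp Require Import freeg.

Set Implicit Arguments.
Unset Strict Implicit.
Unset Printing Implicit Defensive.

Import Order.TTheory GRing.Theory Num.Theory.

Local Open Scope classical_set_scope.
Local Open Scope ring_scope.

Definition padic_norm (p : nat) (r : rat) : rat :=
  if r == 0 then 0 else p%:Q ^ ((logn p `|denq r|)%:Z - (logn p `|numq r|)%:Z).

(* (K, nrm) is the completion of Q for the p-adic absolute value; this
   determines (K, nrm) up to a unique isometric isomorphism, so it says that
   K is Q_p. *)
Record is_Qp (p : nat) (K : fieldType) (nrm : K -> rat) : Prop := IsQp {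
  Qp_norm_ge0 : forall x, 0 <= nrm x ;
  Qp_norm_eq0 : forall x, nrm x = 0 -> x = 0 ;
  Qp_normM : forall x y, nrm (x * y) = nrm x * nrm y ;
  Qp_normD : forall x y, nrm (x + y) <= Num.max (nrm x) (nrm y) ;
  Qp_norm_ratr : forall r : rat, nrm (ratr r) = padic_norm p r ;
  Qp_dense : forall (x : K) (e : rat), 0 < e ->
    exists r : rat, nrm (x - ratr r) < e ;
  Qp_complete : forall u : nat -> K,
    (forall e : rat, 0 < e ->
       exists N, forall m n, (N <= m)%N -> (N <= n)%N -> nrm (u m - u n) < e) ->
    exists l : K, forall e : rat, 0 < e ->
       exists N, forall n, (N <= n)%N -> nrm (u n - l) < e }.

(* {ffun gT -> R} already carries the pointwise product, hence the alias. *)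
Definition grpalg (R : nzRingType) (gT : finGroupType) : Type := {ffun gT -> R}.

Section GroupAlgebra.
Variables (R : nzRingType) (gT : finGroupType).

HB.instance Definition _ := GRing.Lmodule.copy (grpalg R gT) {ffun gT -> R^o}.

Definition gelt (g : gT) : grpalg R gT := [ffun t => (t == g)%:R].

Definition gconv (x y : grpalg R gT) : grpalg R gT :=
  [ffun t => \sum_(s : gT) x s * y (s^-1 * t)%g].

Fact gconvA : associative gconv.
Proof.
move=> x y z; apply/ffunP=> t; rewrite !ffunE.
under eq_bigr => s _ do rewrite ffunE mulr_sumr.
under [in RHS]eq_bigr => s _ do rewrite ffunE mulr_suml.
rewrite [RHS]exchange_big /=; apply: eq_bigr => s _.
rewrite [RHS](reindex_inj (mulgI s)) /=; apply: eq_bigr => r _.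
by rewrite mulKg mulrA invMg mulgA.
Qed.

Fact gconv1x : left_id (gelt 1%g) gconv.
Proof.
move=> x; apply/ffunP=> t; rewrite ffunE (bigD1 1%g) //= big1 ?addr0.
  by rewrite ffunE eqxx mul1r invg1 mul1g.
by move=> s /negbTE s1; rewrite ffunE s1 mul0r.
Qed.

Fact gconvx1 : right_id (gelt 1%g) gconv.
Proof.
move=> x; apply/ffunP=> t; rewrite ffunE (bigD1 t) //= big1 ?addr0.
  by rewrite ffunE mulVg eqxx mulr1.
move=> s st; rewrite ffunE -(inj_eq (mulgI s)) mulgA mulgV mul1g mulg1.
by rewrite eq_sym (negbTE st) mulr0.
Qed.

Fact gconvDl : left_distributive gconv +%R.
Proof.
move=> x y z; apply/ffunP=> t; rewrite !ffunE -big_split /=.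
by apply: eq_bigr => s _; rewrite ffunE mulrDl.
Qed.

Fact gconvDr : right_distributive gconv +%R.
Proof.
move=> x y z; apply/ffunP=> t; rewrite !ffunE -big_split /=.
by apply: eq_bigr => s _; rewrite ffunE mulrDr.
Qed.

Fact gelt1_neq0 : gelt 1%g != 0.
Proof. by apply/eqP=> /ffunP/(_ 1%g)/eqP; rewrite !ffunE eqxx oner_eq0. Qed.

HB.instance Definition _ := GRing.Zmodule_isNzRing.Build (grpalg R gT)
  gconvA gconv1x gconvx1 gconvDl gconvDr gelt1_neq0.

(* xG *)
Definition gcoset (x : grpalg R gT) : set (grpalg R gT) :=
  [set x * gelt g | g in [set: gT]].

Definition gcosetM (X Y : set (grpalg R gT)) : set (grpalg R gT) :=
  [set x * y | x in X & y in Y].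

(* (SG)^* for a subring S of R *)
Definition grpalg_units (S : set R) : set (grpalg R gT) :=
  [set x : grpalg R gT | (forall t, S (x t)) /\
     exists y : grpalg R gT, [/\ forall t, S (y t), x * y = 1 & y * x = 1]].

Definition resolvend (a : {ffun gT -> R}) : grpalg R gT :=
  \sum_(s : gT) a s *: gelt s^-1%g.

End GroupAlgebra.

Section Dual.
Variables (gT : finGroupType) (Fc : fieldType).

Definition is_character (chi : {ffun gT -> Fc}) : bool :=
  (chi 1%g == 1) && [forall s, forall t, chi (s * t)%g == chi s * chi t].

Record dual := Dual { dual_fun :> {ffun gT -> Fc}; _ : is_character dual_fun }.
HB.instance Definition _ := [isSub for dual_fun].
HB.instance Definition _ := [Choice of dual by <:].

Local Notation Zdual := {freeg dual / int}.

Definition dual_prod (psi : Zdual) (s : gT) : Fc :=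
  \prod_(chi <- dom psi) (chi s) ^ (coeff chi psi).

Definition A_dual : set Zdual := [set psi | forall s, dual_prod psi s = 1].

(* The homomorphism Z\hat G -> (F^c)^* attached to a unit x of F^cG. *)
Definition rag (x : grpalg Fc gT) (psi : Zdual) : Fc :=
  \prod_(chi <- dom psi) (\sum_(t : gT) x t * chi t) ^ (coeff chi psi).

Variable zeta : nat -> Fc.

(* The integer upsilon of <chi, s>_* = upsilon / |s|; for |s| odd it exists and
   is unique. *)
Definition stick_num (chi : dual) (s : gT) : int :=
  xget 0 [set v : int | [/\ 1 - #[s]%g%:Z <= v *+ 2, v *+ 2 <= #[s]%g%:Z - 1
                          & chi s = zeta #[s]%g ^ v]].

Definition stick (psi : Zdual) (s : gT) : rat :=
  \sum_(chi <- dom psi)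
    (coeff chi psi)%:~R * ((stick_num chi s)%:~R / #[s]%g%:R).

(* [stick psi s] is an integer when psi is in A_dual, so [Num.floor] is only a
   cast from rat to int there. *)
Definition Theta_hom (g : gT -> Fc) (psi : Zdual) : Fc :=
  \prod_(s : gT) (g s) ^ (Num.floor (stick psi s)).

End Dual.

Section LocalField.
Variables (Qp : fieldType) (absp : Qp -> rat).
Variables (F : fieldExtType Qp) (Fc : closedFieldType).
Variable (iota : {rmorphism F -> Fc}).

Record absgal := AbsGal {
  absgal_fun :> {rmorphism Fc -> Fc} ;
  absgal_bij : bijective absgal_fun ;
  absgal_fix : forall x : F, absgal_fun (iota x) = iota x }.

Definition absgal_mul (w w' : absgal) : absgal :=
  @AbsGal (w \o w') (bij_comp (absgal_bij w) (absgal_bij w'))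
    (fun x => etrans (congr1 w (absgal_fix w' x)) (absgal_fix w x)).

(* Integral closure of Z_p in F^c; the integers of any subfield of F^c are
   obtained by intersection. *)
Definition OFc : set Fc := [set x |
  exists P : {poly Qp}, [/\ P \is monic, forall i, absp P`_i <= 1
                          & root (map_poly (iota \o in_alg F) P) x]].

Definition OF : set F := [set x | OFc (iota x)].

Definition OL (L : set Fc) : set Fc := L `&` OFc.

Definition finite_subext (L : set Fc) : Prop :=
  [/\ forall x : F, L (iota x),
      forall x y, L x -> L y -> L (x - y),
      forall x y, L x -> L y -> L (x * y),
      forall x, L x -> L x^-1
    & exists b : seq Fc, forall x, L x ->
        exists c : nat -> F, x = \sum_(i < size b) iota (c i) * b`_i].

Definition OL_unit (L : set Fc) : set Fc :=
  [set x | [/\ x != 0, OL L x & OL L x^-1]].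

(* x generates the maximal ideal of O_L *)
Definition is_uniformizer (L : set Fc) (x : Fc) : Prop :=
  [/\ x != 0, OL L x, ~ OL_unit L x
    & forall y, OL L y -> ~ OL_unit L y -> OL L (y / x)].

Definition is_residue_card (pi : F) (q : nat) : Prop :=
  exists2 r : 'I_q -> F, forall i, OF (r i)
    & forall x, OF x -> exists! i, OF ((x - r i) / pi).

Section Tame.
Variables (p : nat) (pi : F).

Definition is_ram_index (L : set Fc) (e : nat) : Prop :=
  exists2 x, is_uniformizer L x & OL_unit L (iota pi / x ^+ e).

Definition Fnr : set Fc := [set x |
  exists L, [/\ finite_subext L, is_ram_index L 1 & L x]].

(* Residue extensions are separable, so tameness is a condition on e only. *)
Definition Ft : set Fc := [set x |
  exists L, [/\ finite_subext L, (exists2 e, is_ram_index L e & coprime e p)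
              & L x]].
End Tame.

Definition gal_restr (L : set Fc) (w : absgal) : Fc -> Fc :=
  patch (fun=> 0) L w.

(* F-embeddings of L into F^c, extended by 0 outside L.  Each one is the
   restriction of an element of Omega_F; when L/F is Galois this is Gal(L/F). *)
Record subgal (L : set Fc) := SubGal {
  subgal_fun :> Fc -> Fc ;
  _ : exists w, subgal_fun = gal_restr L w }.

Definition res_gal (L : set Fc) (w : absgal) : subgal L :=
  SubGal (ex_intro (fun w' => gal_restr L w = gal_restr L w') w (erefl _)).

(* The sum over the F-embeddings of L, for L/F finite. *)
Definition traceLF (L : set Fc) (x : Fc) : Fc :=
  \sum_(f \in range (gal_restr L)) f x.

Definition inv_different (L : set Fc) : set Fc :=
  [set x | L x /\ forall y, OL L y -> (iota @` OF) (traceLF L (x * y))].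

Definition is_fractional_ideal (L I : set Fc) : Prop :=
  [/\ I `<=` L,
      exists2 x, I x & x != 0,
      forall x y, I x -> I y -> I (x + y),
      forall c x, OL L c -> I x -> I (c * x)
    & exists2 d, OL L d /\ d != 0 & forall x, I x -> OFc (d * x)].

Definition idealM (I J : set Fc) : set Fc := [set x |
  exists n (f g : 'I_n -> Fc),
    (forall i, I (f i) /\ J (g i)) /\ x = \sum_(i < n) f i * g i].

Section Homs.
Variable gT : finGroupType.

(* Omega_F acts trivially on G, and G is discrete: continuity of a homomorphism
   means that its kernel contains Gal(F^c/F(S)) for some finite S. *)
Definition is_cont_hom (h : absgal -> gT) : Prop :=
  (forall w w', h (absgal_mul w w') = (h w * h w')%g) /\
  exists S : seq Fc, forall w : absgal, {in S, forall x, w x = x} -> h w = 1%g.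

Variable h : absgal -> gT.

Definition fixfield : set Fc :=
  [set x | forall w : absgal, h w = 1%g -> w x = x].

Definition sqrt_inv_different : set Fc :=
  xget set0 [set I | is_fractional_ideal fixfield I /\
                     idealM I I = inv_different fixfield].

Definition F_h : set {ffun gT -> Fc} :=
  [set a | forall (w : absgal) s, w (a s) = a (h w * s)%g].

Definition A_h : set {ffun gT -> Fc} :=
  [set a | F_h a /\ forall s, sqrt_inv_different (a s)].

End Homs.

Section ResolvendCosets.
Variable gT : finGroupType.
Local Notation FcG := (grpalg Fc gT).

(* Linear extension of (s . a)(t) = a(ts). *)
Definition grpalg_act (c : grpalg F gT) (a : {ffun gT -> Fc}) :
    {ffun gT -> Fc} :=
  [ffun t => \sum_(s : gT) iota (c s) * a (t * s)%g].

Definition OFG_span (a : {ffun gT -> Fc}) : set {ffun gT -> Fc} :=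
  [set grpalg_act c a | c in [set c : grpalg F gT | forall s, OF (c s)]].

Definition gal_act (w : absgal) (x : FcG) : FcG := [ffun t => w (x t)].

(* ((SG)^* / G)^{Omega_F}, as a set of cosets xG in F^cG. *)
Definition Hgrp (S : set Fc) : set (set FcG) :=
  [set X | (exists2 x, grpalg_units S x & X = gcoset x) /\
           forall w, gal_act w @` X = X].

Definition HFG : set (set FcG) := Hgrp setT.
Definition HOFG : set (set FcG) := Hgrp OFc.

(* w |-> x^-1 (w . x) for a coset X = xG *)
Definition assoc_hom (X : set FcG) (w : absgal) : gT :=
  xget 1%g [set g | exists2 x, X x & gal_act w x = x * gelt Fc g].

Section Stickelberger.
Variable zeta : nat -> Fc.

(* Equivariant maps G(-1) -> (F^c)^*.  If kappa(w) = k then w . s^k = s in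
   G(-1), so equivariance reads g(s) = w (g (s^k)). *)
Definition Lambda : set (gT -> Fc) := [set g |
  (forall s, g s != 0) /\
  forall (w : absgal) k, let e := exponent [set: gT]%SET in
    w (zeta e) = zeta e ^+ k -> forall s, g s = w (g (s ^+ k)%g)].

(* For g in Lambda, the element of HFG whose restriction to A_dual is
   Theta_hom g (HFG is identified with equivariant homomorphisms on A_dual by
   restriction); a junk value otherwise. *)
Definition Theta (g : gT -> Fc) : set FcG :=
  xget set0 [set X | [/\ Lambda g, HFG X
    & forall x, X x -> forall psi, A_dual psi ->
        rag x psi = Theta_hom zeta g psi]].

End Stickelberger.

Definition f_ (pi : F) (s t : gT) : Fc :=
  if (t == s) && (s != 1%g) then iota pi else 1.

End ResolvendCosets.
End LocalField.

(* Main.v *)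
(* The integers O of F^c form a Galois-stable valuation ring (Hensel), so every
   estimate below is a divisibility in O, applied to coefficients in F^cG.

   Put n = |s| = 2m + 1 and r = pi^(1/n). As n divides q - 1, the n-th roots of
   unity lie in F, and Theta(f_s) is represented by
   theta = \sum_(|k| <= m) r^k e_k, with e_k the idempotents of O_F<s>. An element
   of Omega_F fixing F^nr acts trivially on the residue field, hence does not move
   the unit u of O_(F^c)G by a nontrivial element of G; so h is tame, and sigma
   multiplies u theta by s.

   Let a be given by r_G(a) = u theta and L = F^h. Both theta and theta^-1 have
   norm |r|^-m, and units of O_(F^c)G preserve the norm. With
   theta' = \sum_(0 <= k < n) r^k e_k in place of theta one gets a' with values in
   O_L, and the inverse of u theta' gives the basis dual to a' for the trace form;
   so the inverse different of L/F is {x in L : x r^(2m) in O} and its square root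
   is {x in L : x r^m in O}. Finally, for b in A_h the quotient r_G(b) / (u theta)
   is Galois-invariant with norm at most |r|^-(2m) < |pi|^-1, hence lies in
   O_FG. *)

Require Import Defs.
From HB Require Import structures.
From mathcomp Require Import all_boot all_order all_algebra all_fingroup all_solvable all_field.
From mathcomp Require Import all_classical.
From mathcomp Require Import freeg ring lra zify.

Set Implicit Arguments.
Unset Strict Implicit.
Unset Printing Implicit Defensive.

Import Order.TTheory GRing.Theory Num.Theory.
Local Open Scope classical_set_scope.
Local Open Scope ring_scope.

(** * Hensel's lemma *)

(** The symmetric range of upsilon, available because n is odd, gives theta and theta^-1 the same
    denominator r^m. The range 0, ..., 2m puts the whole denominator r^(2m) into the inverse of
    theta', and this is the exponent that bounds the inverse different. The last estimate is the
    inequality 2m < n.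

    The radical r need not lie in F^h, which in general is a twist of F(r) by the unramified
    contribution of u. Ideals of F^h are therefore cut out by conditions x r^j in O, without a
    uniformizer of F^h, and the place of r^-m inside F^h is taken by a value a(t) of norm exactly
    |r|^-m.

    Two objects are given by choice only. For Theta(f_s), a unit of F^cG that is trivial on the
    relations between characters has to be an element of G; for the square root, two fractional
    ideals with square the inverse different have to coincide.

    Membership in F is tested by Galois invariance. Since F^c is just an algebraically closed
    algebraic extension, enough automorphisms have to be produced by extending embeddings. *)

Section Hensel.
Variables (p : nat) (K : fieldType) (nrm : K -> rat).
Hypothesis KP : is_Qp p nrm.

Lemma Qp_norm0 : nrm 0 = 0.
Proof. by have := Qp_norm_ratr KP 0; rewrite (ratr_nat K 0) /padic_norm eqxx. Qed.

Lemma Qp_norm_eq0P x : (nrm x == 0) = (x == 0).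
Proof.
by apply/eqP/eqP=> [/(Qp_norm_eq0 KP)//|->]; rewrite Qp_norm0.
Qed.

Lemma Qp_norm1 : nrm 1 = 1.
Proof.
have := Qp_normM KP 1 1; rewrite mulr1 => /eqP.
rewrite -subr_eq0 -{1}[nrm 1]mulr1 -mulrBr mulf_eq0 Qp_norm_eq0P oner_eq0 /=.
by rewrite subr_eq0 => /eqP.
Qed.

Lemma Qp_normN x : nrm (- x) = nrm x.
Proof.
have h : nrm (-1) = 1.
  have := Qp_normM KP (-1) (-1); rewrite mulrNN mulr1 Qp_norm1 => /esym/eqP.
  rewrite -expr2 sqrf_eq1 => /orP[/eqP//|/eqP h].
  by have := Qp_norm_ge0 KP (-1); rewrite h.
by rewrite -mulN1r (Qp_normM KP) h mul1r.
Qed.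

Lemma Qp_normV x : nrm x^-1 = (nrm x)^-1.
Proof.
have [->|x0] := eqVneq x 0; first by rewrite invr0 Qp_norm0 invr0.
have nx0 : nrm x != 0 by rewrite Qp_norm_eq0P.
apply: (mulfI nx0); rewrite -(Qp_normM KP) !divff ?Qp_norm1 //.
Qed.

Lemma Qp_normD_le e x y : nrm x <= e -> nrm y <= e -> nrm (x + y) <= e.
Proof.
by move=> hx hy; apply: le_trans (Qp_normD KP x y) _; rewrite ge_max hx.
Qed.

Lemma Qp_normB_le e x y : nrm x <= e -> nrm y <= e -> nrm (x - y) <= e.
Proof. by move=> hx hy; rewrite Qp_normD_le ?Qp_normN. Qed.

Lemma Qp_norm_sum_le e I (r : seq I) (P : pred I) (E : I -> K) : 0 <= e ->
  (forall i, P i -> nrm (E i) <= e) -> nrm (\sum_(i <- r | P i) E i) <= e.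
Proof.
move=> e0 hE; elim/big_ind: _ => //; first by rewrite Qp_norm0.
by move=> x y; apply: Qp_normD_le.
Qed.

Definition gauss_le (e : rat) (P : {poly K}) := forall i, nrm P`_i <= e.

Lemma gauss_le0 e : 0 <= e -> gauss_le e 0.
Proof. by move=> e0 i; rewrite coef0 Qp_norm0. Qed.

Lemma gauss_leD e P Q : gauss_le e P -> gauss_le e Q -> gauss_le e (P + Q).
Proof. by move=> hP hQ i; rewrite coefD Qp_normD_le. Qed.

Lemma gauss_leN e P : gauss_le e P -> gauss_le e (- P).
Proof. by move=> hP i; rewrite coefN Qp_normN. Qed.

Lemma gauss_leW e d P : e <= d -> gauss_le e P -> gauss_le d P.
Proof. by move=> ed hP i; apply: le_trans ed. Qed.

Lemma gauss_leM (e d : rat) P Q : 0 <= e -> 0 <= d ->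
  gauss_le e P -> gauss_le d Q -> gauss_le (e * d) (P * Q).
Proof.
move=> e0 d0 hP hQ i; rewrite coefM; apply: Qp_norm_sum_le => [|j _].
  exact: mulr_ge0.
by rewrite (Qp_normM KP) ler_pM ?(Qp_norm_ge0 KP).
Qed.

Lemma gauss_le_Xn n : gauss_le 1 'X^n.
Proof. by move=> i; rewrite coefXn; case: eqP => _; rewrite ?Qp_norm1 ?Qp_norm0. Qed.

(** Long division: each step subtracts [g] times a monomial whose coefficient is the leading
    coefficient of the current dividend. As [g] is monic and integral, norms never grow. *)
Lemma gauss_le_divmod (d : rat) g e : 0 <= d -> g \is monic -> gauss_le 1 g ->
  gauss_le d e -> gauss_le d (e %/ g) /\ gauss_le d (e %% g).
Proof.
move=> d0 mg hg; have g0 := monic_neq0 mg.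
have [n] := ubnP (size e); elim: n e => // n IH e /ltnSE sen he.
have [sz|sz] := ltnP (size e) (size g).
  by rewrite divp_small // modp_small //; split=> //; apply: gauss_le0.
have e0 : e != 0.
  by rewrite -size_poly_gt0 (leq_trans _ sz) // size_poly_gt0.
set l := lead_coef e; pose m := l *: 'X^(size e - size g) : {poly K}.
have hl : nrm l <= d by apply: he.
have hm : gauss_le d m.
  by move=> i; rewrite coefZ (Qp_normM KP) -[leRHS]mulr1 ler_pM ?(Qp_norm_ge0 KP) ?gauss_le_Xn.
have hmg : gauss_le d (m * g) by rewrite -[d]mulr1; apply: gauss_leM.
have se : (size (e - m * g)%R < size e)%N.
  have smg : size (m * g)%R = size e.
    have m0 : m != 0 by rewrite scaler_eq0 lead_coef_eq0 (negbTE e0) -size_poly_eq0 size_polyXn.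
    rewrite size_mul // size_scale ?lead_coef_eq0 // size_polyXn addSn /=.
    by rewrite subnK.
  have e1 : (0 < size e)%N by rewrite size_poly_gt0.
  rewrite -(prednK e1) ltnS; apply/leq_sizeP => j; rewrite leq_eqVlt => /orP[/eqP<-|hj].
    rewrite coefB -{2}smg -!lead_coefE lead_coefM lead_coefZ lead_coefXn.
    by rewrite (monicP mg) !mulr1 subrr.
  by rewrite coefB !nth_default ?subrr // ?smg; rewrite prednK in hj.
have [h1 h2] := IH (e - m * g) (leq_trans se sen) (gauss_leD he (gauss_leN hmg)).
have -> : e = m * g + (e - m * g) by rewrite addrC subrK.
rewrite divp_addl_mul // modpD modp_mull add0r.
by split=> //; apply: gauss_leD.
Qed.

Lemma rat_geom_small (a C e : rat) : 0 <= a < 1 -> 0 < e ->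
  exists N, forall n, (N <= n)%N -> a ^+ n * C < e.
Proof.
move=> /andP[a0 a1] e0; case: (lerP C 0) => [C0|C0].
  exists 0%N => n _; apply: le_lt_trans e0.
  by rewrite mulr_ge0_le0 // exprn_ge0.
have [->|an0] := eqVneq a 0.
  by exists 1%N => -[//|n] _; rewrite expr0n mul0r.
have {an0}a0 : 0 < a by rewrite lt_def an0.
pose b := a^-1 - 1; have b0 : 0 < b by rewrite subr_gt0 invf_gt1.
(* Bernoulli's inequality for [a^-1 = 1 + b]. *)
have bern n : 1 + n%:R * b <= a^-1 ^+ n.
  elim: n => [|n IHn]; first by rewrite mul0r addr0.
  have ai0 : 0 <= a^-1 by rewrite invr_ge0 ltW.
  rewrite exprS; apply: le_trans (ler_wpM2l ai0 IHn).
  have aib : a^-1 = 1 + b by rewrite addrC subrK.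
  have : 0 <= b * (n%:R * b) by rewrite !mulr_ge0 ?ler0n ?ltW.
  by rewrite aib -natr1; lra.
pose N := Num.bound (C / e / b); exists N => n Nn.
have hN : C / e / b < n%:R.
  have := archi_boundP (x := C / e / b); rewrite !divr_ge0 ?ltW // => /(_ isT).
  by move/lt_le_trans; apply; rewrite ler_nat.
have h : C / e < a^-1 ^+ n.
  by apply: lt_le_trans (bern n); rewrite ltr_pdivrMr // in hN; lra.
rewrite ltr_pdivrMr // exprVn mulrC ltr_pdivlMr ?exprn_gt0 // in h.
by rewrite mulrC.
Qed.

Lemma Qp_geometric_lim (u : nat -> K) (a : rat) : 0 <= a < 1 ->
  (forall n, nrm (u n.+1 - u n) <= a ^+ n) ->
  exists l, forall n, nrm (u n - l) <= a ^+ n.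
Proof.
move=> a01 hu; have /andP[a0 a1] := a01.
have step n k : nrm (u (n + k)%N - u n) <= a ^+ n.
  elim: k => [|k IHk]; first by rewrite addn0 subrr Qp_norm0 exprn_ge0.
  rewrite -(subrK (u (n + k)%N) (u _)) -addrA Qp_normD_le // addnS.
  by apply: le_trans (hu _) _; rewrite ler_wiXn2l ?leq_addr // ltW.
have step2 n m : (n <= m)%N -> nrm (u m - u n) <= a ^+ n.
  by move=> /subnKC <-.
have [|l hl] := Qp_complete KP (u := u).
  move=> e /(rat_geom_small 1 a01)[N hN]; exists N => m n Nm Nn.
  apply: le_lt_trans (hN N (leqnn N)); rewrite mulr1.
  have -> : u m - u n = (u m - u N) - (u n - u N) by ring.
  by rewrite Qp_normB_le ?step2.
(* For [a = 0] the bound [a ^+ n] is no positive radius at which the limit could be approximated;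
   here the sequence is constant from index 1 on. *)
exists l => n; case: (eqVneq a 0) => [a00|an0].
  have ue m : (0 < m)%N -> u m = u m.+1.
    move=> m0; apply/esym/eqP; rewrite -subr_eq0 -Qp_norm_eq0P eq_le (Qp_norm_ge0 KP).
    by rewrite andbT; apply: le_trans (hu m) _; rewrite a00 expr0n; case: m m0.
  have uc m : u m.+1 = u 1%N by elim: m => // m <-; rewrite [RHS]ue.
  have lu : l = u 1%N.
    apply/eqP; rewrite -subr_eq0 -Qp_norm_eq0P eq_le (Qp_norm_ge0 KP) andbT.
    rewrite -Qp_normN opprB leNgt; apply/negP=> /hl[N /(_ N.+1 (leqnSn N))].
    by rewrite uc ltxx.
  case: n => [|n]; rewrite lu ?uc; first by rewrite -Qp_normN opprB hu.
  by rewrite subrr Qp_norm0 exprn_ge0.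
have en : 0 < a ^+ n by rewrite exprn_gt0 // lt_def an0.
have [N hN] := hl _ en.
rewrite -(subrK (u (maxn n N)) (u n)) -addrA Qp_normD_le //.
  by rewrite -Qp_normN opprB step2 // leq_maxl.
by rewrite ltW // hN // leq_maxr.
Qed.

Lemma gauss_geometric_lim (u : nat -> {poly K}) (a : rat) d : 0 <= a < 1 ->
  (forall n, (size (u n) <= d)%N) ->
  (forall n, gauss_le (a ^+ n) (u n.+1 - u n)) ->
  exists l : {poly K}, (size l <= d)%N /\ forall n, gauss_le (a ^+ n) (u n - l).
Proof.
move=> a01 hd hu; have /andP[a0 _] := a01.
have /choice[l hl] i : exists l, forall n, nrm ((u n)`_i - l) <= a ^+ n.
  by apply: Qp_geometric_lim a01 _ => n; rewrite -coefB hu.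
exists (\poly_(i < d) l i); split=> [|n i]; first exact: size_poly.
rewrite coefB coef_poly; case: ltnP => // di.
by rewrite nth_default ?subr0 ?Qp_norm0 ?exprn_ge0 // (leq_trans (hd n)).
Qed.

(** Modulo the maximal ideal [f] is monic of degree [r]. The factor [g] lifts this reduction and [h]
    lifts the constant 1; since [h] stays close to 1, division by [g] alone computes the Newton
    correction. *)
Lemma hensel_factor (f : {poly K}) r : gauss_le 1 f -> f`_r = 1 -> (0 < r)%N ->
  (r.+1 < size f)%N -> (forall i, (r < i)%N -> nrm f`_i < 1) ->
  exists g h, [/\ f = g * h, (1 < size g)%N & (size g < size f)%N].
Proof.
move=> hf fr r0 rs fi1.
(* The largest norm of a coefficient beyond degree [r]: it bounds the initial error and is the
   contraction factor of every later step. *)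
pose a : rat := \big[Num.max/0]_(i < size f | (r < i)%N) nrm f`_i.
have a01 : 0 <= a < 1.
  by rewrite /a; elim/big_ind: _ => // [x y /andP[x0 x1] /andP[y0 y1]|i ri];
    rewrite ?le_max ?gt_max ?x0 ?x1 // (Qp_norm_ge0 KP) fi1.
have /andP[a0 a1] := a01.
have fia i : (r < i)%N -> nrm f`_i <= a.
  move=> ri; case: (ltnP i (size f)) => [si|si]; last by rewrite nth_default ?Qp_norm0.
  by rewrite /a (bigD1 (Ordinal si)) //= le_max lexx.
(* Newton step: if [f - g * h = q * g + t] then the error of [(g + t, h + q)] is
   [- t * (h + q - 1)], smaller by a factor [a]. *)
pose E (gh : {poly K} * {poly K}) : {poly K} := f - gh.1 * gh.2.
pose nxt (gh : {poly K} * {poly K}) : {poly K} * {poly K} :=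
  (gh.1 + E gh %% gh.1, gh.2 + E gh %/ gh.1).
pose gh j := iter j nxt (take_poly r.+1 f, 1).
pose inv (j : nat) (gh : {poly K} * {poly K}) :=
  [/\ gh.1 \is monic /\ size gh.1 = r.+1, gauss_le 1 gh.1,
      (size gh.2 <= size f - r)%N, gauss_le a (gh.2 - 1) & gauss_le (a ^+ j.+1) (E gh)].
have aux (b : nat) : (b <= size f - r)%N -> (r + b <= size f)%N.
  by move=> hb; move: rs; lia.
have stp j x : inv j x -> [/\ inv j.+1 (nxt x), gauss_le (a ^+ j.+1) ((nxt x).1 - x.1)
    & gauss_le (a ^+ j.+1) ((nxt x).2 - x.2)].
  case: x => g h [] /= [mg sg] hg sh hh he.
  have [hq ht] := gauss_le_divmod (exprn_ge0 _ a0) mg hg he.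
  have aj : a ^+ j.+1 <= a by rewrite exprS ler_piMr // exprn_ile1 // ltW.
  have st : (size (E (g, h) %% g)%R < size g)%N by rewrite ltn_modp monic_neq0.
  have sE : (size (E (g, h)) <= size f)%N.
    apply: leq_trans (size_polyD _ _) _; rewrite size_polyN geq_max leqnn /=.
    apply: leq_trans (size_polyMleq _ _) _; rewrite /= sg addSn /=; exact: aux sh.
  have hh' : gauss_le a (h + E (g, h) %/ g - 1).
    by rewrite addrAC; apply: gauss_leD hh (gauss_leW aj hq).
  rewrite /nxt /=; split=> /=; [|by rewrite addrAC subrr add0r|by rewrite addrAC subrr add0r].
  split=> //=.
  - rewrite size_polyDl // sg; split=> //.
    by rewrite monicE lead_coefDl.
  - by apply: gauss_leD hg (gauss_leW _ ht); rewrite (le_trans aj) ?ltW.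
  - apply: leq_trans (size_polyD _ _) _; rewrite geq_max sh /=.
    by rewrite size_divp ?monic_neq0 // sg /= leq_sub2r.
  have -> : E (g + E (g, h) %% g, h + E (g, h) %/ g)
      = - ((E (g, h) %% g) * (h + E (g, h) %/ g - 1)).
    rewrite {1}/E /=; have := divp_eq (E (g, h)) g.
    set q := _ %/ _; set t := _ %% _; rewrite {1}/E /= => /eqP.
    rewrite subr_eq => /eqP ->; ring.
  apply: gauss_leN; rewrite exprSr; apply: gauss_leM => //; exact: exprn_ge0.
have inv0 : inv 0%N (gh 0%N).
  have stk : size (take_poly r.+1 f) = r.+1.
    apply/eqP; rewrite eqn_leq size_take_poly /= ltnNge; apply/negP=> /leq_sizeP/(_ r (leqnn r)).
    by rewrite coef_take_poly ltnSn fr; apply/eqP/oner_neq0.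
  split=> /=.
  - by rewrite stk monicE lead_coefE stk /= coef_take_poly ltnSn fr.
  - by move=> i; rewrite coef_take_poly; case: ifP => _; rewrite ?hf ?Qp_norm0.
  - by rewrite size_poly1 subn_gt0 ltnW.
  - by rewrite subrr; apply: gauss_le0.
  rewrite expr1 => i; rewrite /E /= mulr1 coefB coef_take_poly.
  case: ltnP => ri; first by rewrite subrr Qp_norm0.
  by rewrite subr0 fia.
have invj j : inv j (gh j) by elim: j => // j /stp[].
have aS j : a ^+ j.+1 <= a ^+ j by rewrite exprS ler_piMl ?exprn_ge0 // ltW.
have [|j|g [sg hg]] := gauss_geometric_lim (u := fun j => (gh j).1) (d := r.+1) a01.
- by move=> j; have [[_ ->]] := invj j.
- by have [_ h _] := stp _ _ (invj j); apply: gauss_leW h.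
have [|j|h [sh hh]] := gauss_geometric_lim (u := fun j => (gh j).2) (d := size f - r) a01.
- by move=> j; have [_ _] := invj j.
- by have [_ _ h] := stp _ _ (invj j); apply: gauss_leW h.
have fgh : f = g * h.
  apply/eqP; rewrite -subr_eq0; apply/eqP/polyP=> i; rewrite coef0; apply/eqP.
  rewrite -Qp_norm_eq0P eq_le (Qp_norm_ge0 KP) andbT leNgt; apply/negP=> e0.
  have [N hN] := rat_geom_small 1 a01 e0.
  have := hN N (leqnn N); rewrite mulr1 ltNge => /negP; apply.
  have [[mg sgN] gN shN hN1 eN] := invj N.
  have -> : f - g * h = E (gh N) + ((gh N).1 - g) * (gh N).2
      + g * ((gh N).2 - h) by rewrite /E; ring.
  have h2 : gauss_le 1 (gh N).2.
    rewrite -(subrK 1 (gh N).2); apply: gauss_leD (gauss_le_Xn 0).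
    by apply: gauss_leW hN1; apply: ltW.
  have hg1 : gauss_le 1 g.
    have -> : g = (gh N).1 - ((gh N).1 - g) by ring.
    apply: gauss_leD gN (gauss_leN _); apply: gauss_leW (hg N).
    by rewrite exprn_ile1 // ltW.
  apply: gauss_leD; first apply: gauss_leD.
  - exact: gauss_leW eN.
  - by rewrite -[a ^+ N]mulr1; apply: gauss_leM => //; apply: exprn_ge0.
  - by rewrite -[a ^+ N]mul1r; apply: gauss_leM => //; apply: exprn_ge0.
exists g, h; split=> //; last exact: leq_ltn_trans sg rs.
have f0 : f != 0 by rewrite -size_poly_gt0 (leq_trans _ rs).
have /norP[g0 h0] : ~~ ((g == 0) || (h == 0)) by rewrite -mulf_eq0 -fgh.
by have : size f = (size g + size h).-1 by [rewrite fgh size_mul]; lia.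
Qed.

End Hensel.

(** * Extension of automorphisms to the algebraic closure *)

Lemma monic_size_le1 (R : nzRingType) (P : {poly R}) :
  P \is monic -> (size P <= 1)%N -> P = 1.
Proof.
by move=> mP /size1_polyC e; move: (monicP mP); rewrite e lead_coefC => ->.
Qed.

Section ExtendAutomorphisms.
Variables (F : fieldType) (Fc : closedFieldType) (iota : {rmorphism F -> Fc}).
Hypothesis Fc_alg : forall x : Fc, algebraicOver iota x.
Hypothesis Fc_char0 : forall n, n.+1%:R != 0 :> Fc.

(* Graph of an F-homomorphism from a subring of [Fc] to [Fc]: with graphs, the
   union of a chain in Zorn's lemma is a plain union of sets. *)
Record hom_graph (G : set (Fc * Fc)) : Prop := HomGraph {
  hom_graph_diag : forall c, G (iota c, iota c) ;
  hom_graphB : forall a b, G a -> G b -> G (a - b) ;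
  hom_graphM : forall a b, G a -> G b -> G (a * b) ;
  hom_graph0 : forall b, G (0, b) -> b = 0 }.

Section GraphRing.
Variables (G : set (Fc * Fc)) (hG : hom_graph G).

Definition graph_pred of hom_graph G : {pred Fc * Fc} := [pred x | `[< G x >]].

Lemma graph_predP x : reflect (G x) (x \in graph_pred hG).
Proof. exact: asboolP. Qed.

Fact graph_pred_subring : subring_closed (graph_pred hG).
Proof.
split=> [|x y|x y]; first apply/graph_predP.
- by have := hom_graph_diag hG 1; rewrite rmorph1.
- by move=> /graph_predP hx /graph_predP hy; apply/graph_predP; apply: hom_graphB.
- by move=> /graph_predP hx /graph_predP hy; apply/graph_predP; apply: hom_graphM.
Qed.

HB.instance Definition _ :=
  GRing.isSubringClosed.Build (Fc * Fc)%type (graph_pred hG) graph_pred_subring.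

Record graph_type := GraphElt { graph_val : Fc * Fc; _ : graph_val \in graph_pred hG }.
HB.instance Definition _ := [isSub for graph_val].
HB.instance Definition _ := [Choice of graph_type by <:].
HB.instance Definition _ := [SubChoice_isSubComNzRing of graph_type by <:].

Local Notation fstG := (fst \o (val : graph_type -> Fc * Fc)).
Local Notation sndG := (snd \o (val : graph_type -> Fc * Fc)).

Lemma graph_valP (x : graph_type) : G (val x).
Proof. exact/graph_predP/valP. Qed.

Definition graph_mk x (hx : G x) : graph_type :=
  Sub x (introT (graph_predP x) hx).

Definition graph_const (c : F) : graph_type := graph_mk (hom_graph_diag hG c).

Lemma fstG_eq0 (x : graph_type) : (fstG x == 0) = (x == 0).
Proof.
apply/eqP/eqP=> [h|->]; last by rewrite rmorph0.
apply/val_inj; rewrite rmorph0; move: (graph_valP x) h => /=.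
by case: (graph_val x) => a b + /= a0; rewrite a0 => /(hom_graph0 hG) ->.
Qed.

Lemma fstG_inj : injective fstG.
Proof.
by move=> x y /eqP; rewrite -subr_eq0 -rmorphB fstG_eq0 subr_eq0 => /eqP.
Qed.

(** The inverse is algebraic over F, and multiplying a monic relation of degree d + 1 for [x^-1] by
    [x^d] expresses [x^-1] as a polynomial in [x]. So the domain of a graph is automatically a
    field. *)
Lemma graph_inv (x : graph_type) : x != 0 -> exists y : graph_type, y * x = 1.
Proof.
move=> x0; have a0 : fstG x != 0 by rewrite fstG_eq0.
have /integral_algebraic[P mP rP] := Fc_alg (fstG x)^-1.
have szP : (1 < size P)%N.
  rewrite ltnNge; apply/negP=> sz; have P1 := monic_size_le1 mP sz.
  by move: rP; rewrite P1 -polyC1 map_polyC /root hornerC /= rmorph1 oner_eq0.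
pose d := (size P).-2.
have szd : size P = d.+2 by rewrite /d; case: (size P) szP => [|[]].
pose r : graph_type := - \sum_(i < d.+1) graph_const P`_i * x ^+ (d - i).
suff rE : fstG r = (fstG x)^-1.
  exists r; apply: fstG_inj; apply: etrans (rmorph1 fstG).
  by rewrite -[RHS](mulVf a0) -rE; apply: (rmorphM fstG).
rewrite rmorphN rmorph_sum; apply/eqP; rewrite eqr_oppLR; apply/eqP.
have xn : fstG x ^+ d != 0 by rewrite expf_neq0.
have := rootP rP; rewrite horner_coef size_map_poly szd big_ord_recr /=.
rewrite coef_map /= -[P`_d.+1](_ : lead_coef P = _); last by rewrite lead_coefE szd.
rewrite (monicP mP) rmorph1 mul1r => /eqP; rewrite addr_eq0 => /eqP e.
have e2 : fstG x ^+ d * (fstG x)^-1 ^+ d.+1 = (fstG x)^-1.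
  by rewrite exprVn exprS invfM mulrCA divff ?mulr1.
rewrite -e2 -mulrN -e mulr_sumr; apply: eq_bigr => i _.
rewrite coef_map /= mulrCA; congr (_ * _).
rewrite -[LHS]/(fstG (x ^+ (d - i))) (rmorphXn fstG).
have id : (i <= d)%N by rewrite -ltnS.
have /esym dE := subnK id.
by rewrite [in X in _ = X * _]dE exprD -mulrA -exprMn divff ?expr1n ?mulr1.
Qed.

Lemma graph_minpoly a : exists Q : {poly graph_type},
  [/\ Q \is monic, root (map_poly fstG Q) a &
      forall T : {poly graph_type}, (size T < size Q)%N ->
        root (map_poly fstG T) a -> T = 0].
Proof.
pose A n := `[< exists T : {poly graph_type},
  [/\ T != 0, root (map_poly fstG T) a & size T = n] >].
have exA : exists n, A n.
  have [P P0 rP] := Fc_alg a; exists (size P); apply/asboolP.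
  pose T : {poly graph_type} := \poly_(i < size P) graph_const P`_i.
  have TE : map_poly fstG T = map_poly iota P.
    apply/polyP=> i; rewrite !coef_map coef_poly /=; case: ltnP => //= hi.
    by rewrite nth_default // rmorph0.
  exists T; rewrite TE; split=> //.
    apply/eqP=> T0; move: TE; rewrite T0 rmorph0 => /esym/eqP.
    by rewrite map_poly_eq0 (negbTE P0).
  by rewrite -(size_map_inj_poly fstG_inj) ?rmorph0 // TE size_map_poly.
have [n /asboolP[T [T0 rT sT]] nmin] := ex_minnP exA.
have [c hc] : exists c, c * lead_coef T = 1 by apply: graph_inv; rewrite lead_coef_eq0.
have lc : lead_coef (c *: T) = 1.
  apply/eqP; rewrite lead_coefE; have sc : (size (c *: T) = size T).
    apply/eqP; rewrite eqn_leq size_scale_leq /=.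
    rewrite leqNgt; apply/negP=> h; have : (c *: T)`_(size T).-1 = 0.
      by rewrite nth_default // -ltnS prednK // size_poly_gt0.
    by rewrite coefZ -lead_coefE hc => /eqP; rewrite oner_eq0.
  by rewrite sc coefZ -lead_coefE hc.
exists (c *: T); split; first by rewrite monicE lc.
  by rewrite map_polyZ rootE hornerZ (rootP rT) mulr0.
move=> S sS rS; apply/eqP; apply: contraT => S0.
have : (n <= size S)%N by apply: nmin; apply/asboolP; exists S.
by rewrite leqNgt -sT (leq_trans sS) // size_scale_leq.
Qed.

Definition graph_adjoin (a b : Fc) : set (Fc * Fc) :=
  [set x | exists T : {poly graph_type},
     x = ((map_poly fstG T).[a], (map_poly sndG T).[b])].

(** The assignment T(a) |-> T(b) is well defined: division by the monic [Q] leaves a remainder that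
    kills [a] and is too short to be nonzero, so T(a) = 0 makes [T] a multiple of [Q], which also
    kills [b]. *)
Lemma graph_adjoinP a b (Q : {poly graph_type}) : Q \is monic ->
  root (map_poly fstG Q) a -> root (map_poly sndG Q) b ->
  (forall T : {poly graph_type}, (size T < size Q)%N ->
        root (map_poly fstG T) a -> T = 0) ->
  [/\ hom_graph (graph_adjoin a b), G `<=` graph_adjoin a b
    & graph_adjoin a b (a, b)].
Proof.
move=> mQ ra rb minQ.
have sub : G `<=` graph_adjoin a b.
  move=> x hx; exists (graph_mk hx)%:P; rewrite !map_polyC !hornerC /=.
  by case: x hx.
split=> //; last by exists 'X; rewrite !map_polyX !hornerX.
split.
- by move=> c; apply/sub/(hom_graph_diag hG).
- move=> _ _ [S ->] [T ->]; exists (S - T).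
  by rewrite !rmorphB !hornerE.
- move=> _ _ [S ->] [T ->]; exists (S * T).
  by rewrite !rmorphM !hornerE.
move=> y [T [Ta ->]].
have TE := Pdiv.RingMonic.rdivp_eq mQ T.
have r0 : Pdiv.Ring.rmodp T Q = 0.
  apply: minQ; first by rewrite Pdiv.Ring.ltn_rmodpN0 // monic_neq0.
  have : root (map_poly fstG T) a by rewrite rootE; apply/eqP/esym.
  by rewrite {1}TE rmorphD rmorphM /= !rootE hornerD hornerM (rootP ra) mulr0 add0r.
suff : root (map_poly sndG T) b by move/rootP.
by rewrite TE r0 addr0 rmorphM rootM rb orbT.
Qed.

Lemma graph_adjoin_exists a : exists b G', [/\ hom_graph G', G `<=` G' & G' (a, b)].
Proof.
have [Q [mQ ra minQ]] := graph_minpoly a.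
have /closed_rootP[b rb] : size (map_poly sndG Q) != 1%N.
  rewrite (size_map_poly_id0 (f := sndG)); last first.
    by rewrite (monicP mQ) rmorph1 oner_eq0.
  apply/negP=> /eqP sQ; have Q1 : Q = 1 by apply: monic_size_le1; rewrite ?sQ.
  move: ra; rewrite Q1 -polyC1 map_polyC /root hornerC.
  by rewrite -[X in X == _]/(fstG 1) (rmorph1 fstG) oner_eq0.
by exists b, (graph_adjoin a b); apply: graph_adjoinP mQ ra rb minQ.
Qed.

End GraphRing.

Lemma hom_graph_extends G : hom_graph G ->
  exists w : {rmorphism Fc -> Fc}, forall x y, G (x, y) -> w x = y.
Proof.
(* Zorn's lemma is applied to the sets added to [G], because the empty chain has empty union and the
   empty set is no graph. *)
move=> hG; pose P (A : set (Fc * Fc)) := hom_graph (G `|` A).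
have [C CP Ctot|A [PA maxA]] := Zorn_bigcup (P := P).
  have com a b : (G `|` \bigcup_(X in C) X) a -> (G `|` \bigcup_(X in C) X) b ->
     (G a /\ G b) \/ exists X, [/\ C X, (G `|` X) a & (G `|` X) b].
    move=> [Ga|[X CX Xa]] [Gb|[Y CY Yb]].
    - by left.
    - by right; exists Y; split=> //; [left|right].
    - by right; exists X; split=> //; [right|left].
    - right; have [XY|YX] := Ctot X Y CX CY.
        by exists Y; split=> //; right=> //; apply: XY.
      by exists X; split=> //; right=> //; apply: YX.
  have up X : C X -> (G `|` X) `<=` (G `|` \bigcup_(X in C) X).
    by move=> CX a [|Xa]; [left | right; exists X].
  split.
  - by move=> c; left; apply: hom_graph_diag.
  - move=> a b /com/[apply] -[[Ga Gb]|[X [CX Xa Xb]]].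
      by left; apply: hom_graphB.
    by apply: (up X CX); apply: (hom_graphB (CP X CX)).
  - move=> a b /com/[apply] -[[Ga Gb]|[X [CX Xa Xb]]].
      by left; apply: hom_graphM.
    by apply: (up X CX); apply: (hom_graphM (CP X CX)).
  - move=> b [|[X CX Xb]]; first exact: hom_graph0.
    by apply: (hom_graph0 (CP X CX)); right.
set H := G `|` A in PA; have hH : hom_graph H := PA.
have tot a : exists b, H (a, b).
  have [b [G' [hG' HG' G'ab]]] := graph_adjoin_exists hH a.
  exists b; apply: contrapT => nH; apply: (maxA G').
    split; first by move=> x Ax; apply: HG'; right.
    by move=> G'A; apply: nH; right; apply: G'A.
  by rewrite /P (_ : G `|` G' = G') //; apply/setUidPr => x Gx; apply: HG'; left.
have [f fH] := choice tot.
have fE x y : H (x, y) -> f x = y.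
  move=> h; apply/eqP; rewrite -subr_eq0; apply/eqP/(hom_graph0 hH).
  have e : (x, f x) - (x, y) = (0, f x - y) by congr (_, _); apply: subrr.
  by rewrite -e; apply: hom_graphB.
have fB : zmod_morphism f by move=> x y; apply: fE; apply: (hom_graphB hH (fH x) (fH y)).
have fM : monoid_morphism f.
  split; first by apply: fE; have := hom_graph_diag hH 1; rewrite rmorph1.
  by move=> x y; apply: fE; apply: (hom_graphM hH (fH x) (fH y)).
pose w : {rmorphism Fc -> Fc} := HB.pack f (GRing.isZmodMorphism.Build _ _ f fB)
  (GRing.isMonoidMorphism.Build _ _ f fM).
by exists w => x y Gxy; apply: fE; left.
Qed.

(** Each [y] is one of the finitely many roots of a polynomial over F; an injective map over F
    permutes these roots. *)
Lemma endomorphism_bij (w : {rmorphism Fc -> Fc}) :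
  (forall c, w (iota c) = iota c) -> bijective w.
Proof.
move=> wF; have winj : injective w := fmorph_inj w.
suff surj y : exists x, w x = y.
  have [g gK] := choice surj; exists g => x //; exact: winj.
have [P P0 rP] := Fc_alg y.
have [rs rsE] := closed_field_poly_normal (map_poly iota P).
have l0 : lead_coef (map_poly iota P) != 0 by rewrite lead_coef_eq0 map_poly_eq0.
have rootE' z : root (map_poly iota P) z = (z \in undup rs).
  by rewrite mem_undup rsE rootZ // root_prod_XsubC.
have wP : map_poly w (map_poly iota P) = map_poly iota P.
  by rewrite -map_poly_comp; apply: eq_map_poly => c /=.
have ws : {subset map w (undup rs) <= undup rs}.
  move=> _ /mapP[z + ->]; rewrite -!rootE' => rz.
  by rewrite -wP fmorph_root.
have us : uniq (map w (undup rs)) by rewrite map_inj_uniq // undup_uniq.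
have [_ es] := uniq_min_size us ws (eq_leq (esym (size_map _ _))).
move: rP; rewrite rootE' -es => /mapP[x _ ->]; by exists x.
Qed.

Definition diag_graph : set (Fc * Fc) := [set x | exists c, x = (iota c, iota c)].

Lemma hom_graph_diag_graph : hom_graph diag_graph.
Proof.
split.
- by move=> c; exists c.
- by move=> _ _ [c ->] [d ->]; exists (c - d); rewrite rmorphB.
- by move=> _ _ [c ->] [d ->]; exists (c * d); rewrite rmorphM.
- by move=> b [c [c0 ->]].
Qed.

(** The minimal polynomial [Q] of [y] over F has degree at least 2. A second root of [Q] is the
    image of [y] under some extension. Without one, [Q] is a power of X - y, so its derivative kills
    [y] and must vanish by minimality, against characteristic 0. *)
Lemma moved_by_endomorphism y : (forall c, y != iota c) ->
  exists w : {rmorphism Fc -> Fc}, (forall c, w (iota c) = iota c) /\ w y != y.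
Proof.
move=> yF; have hD := hom_graph_diag_graph.
have [Q [mQ ra minQ]] := graph_minpoly hD y.
have diagE (x : graph_type hD) : (val x).1 = (val x).2.
  by have [c ->] := graph_valP x.
have sQ : (2 < size Q)%N.
  rewrite ltnNge; apply/negP => sz.
  have sz1 : size Q != 1%N.
    apply/negP=> /eqP sQ; have Q1 : Q = 1 by apply: monic_size_le1; rewrite ?sQ.
    move: ra; rewrite Q1 -polyC1 map_polyC /root hornerC.
    by rewrite -[X in X == _]/((fst \o val) (1 : graph_type hD)) rmorph1 oner_eq0.
  have szQ : size Q = 2%N.
    apply/eqP; rewrite eqn_leq sz /= ltn_neqAle eq_sym sz1 size_poly_gt0.
    exact: monic_neq0.
  move: ra; rewrite rootE horner_coef (size_map_poly_id0 (f := fst \o val)); last first.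
    by rewrite (monicP mQ) -[X in X != _]/((fst \o val) (1 : graph_type hD)) rmorph1 oner_eq0.
  rewrite szQ big_ord_recl big_ord1 !coef_map /= expr0 mulr1 expr1.
  have -> : Q`_(bump 0 0) = 1 by move: (monicP mQ); rewrite lead_coefE szQ.
  rewrite -[X in _ + X * _]/((fst \o val) (1 : graph_type hD)) rmorph1 mul1r addrC addr_eq0.
  have [c cE] := graph_valP (Q`_0).
  rewrite -[graph_val _]/(val _) cE /= => /eqP e.
  by have /eqP[] := yF (- c); rewrite rmorphN.
set Q1 := map_poly (fst \o val) Q in ra.
have sQ1 : size Q1 = size Q.
  rewrite (size_map_poly_id0 (f := fst \o val)) //.
  by rewrite (monicP mQ) -[X in X != _]/((fst \o val) (1 : graph_type hD)) rmorph1 oner_eq0.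
have mQ1 : Q1 \is monic by apply: monic_map.
have [rs rsE] := closed_field_poly_normal Q1.
rewrite (monicP mQ1) scale1r in rsE.
have [/hasP[z zrs zy]|/hasPn ally] := boolP (has (predC1 y) rs).
  have rz : root (map_poly (snd \o val) Q) z.
    rewrite (_ : map_poly _ Q = Q1); first by rewrite rsE root_prod_XsubC.
    by apply: eq_map_poly => x /=; rewrite -[graph_val x]/(val x) diagE.
  have [hG sub yz] := graph_adjoinP mQ ra rz minQ.
  have [w wE] := hom_graph_extends hG.
  exists w; split; first by move=> c; apply: wE; apply: sub; exists c.
  by rewrite (wE _ _ yz).
have rsy : rs = nseq (size rs) y.
  by apply/all_pred1P/allP => x /ally; rewrite negbK.
have szrs : size Q = (size rs).+1 by rewrite -sQ1 rsE size_prod_XsubC.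
have Q1E : Q1 = ('X - y%:P) ^+ (size rs).
  by rewrite rsE rsy big_nseq size_nseq -Monoid.iteropE.
have : Q^`() = 0.
  apply: minQ; first by rewrite lt_size_deriv // monic_neq0.
  rewrite -deriv_map -/Q1 Q1E deriv_exp rootE hornerMn hornerM horner_exp.
  rewrite hornerXsubC subrr expr0n -subn1 subn_eq0 leqNgt.
  by rewrite -ltnS -szrs sQ mulr0 mul0rn.
move/polyP/(_ (size rs).-1); rewrite coef0 coef_deriv.
case E : (size rs) szrs => [|n] /= szrs; first by rewrite szrs in sQ.
have -> : Q`_n.+1 = 1 by move: (monicP mQ); rewrite lead_coefE szrs.
move/(congr1 (fst \o val)); rewrite rmorph_nat rmorph0 => /eqP.
by rewrite (negbTE (Fc_char0 n)).
Qed.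

End ExtendAutomorphisms.

(** * Group algebras and characters *)

Lemma sum_shift_periodic (V : zmodType) n (f : nat -> V) :
  f n = f 0%N -> \sum_(i < n) f i.+1 = \sum_(i < n) f i.
Proof.
move=> fn; apply: (addrI (f 0%N)).
have := big_ord_recl n (fun i : 'I_n.+1 => f i) => /= <-.
by rewrite big_ord_recr /= fn addrC.
Qed.

Lemma divf_eq1 (K : fieldType) (a b : K) : b != 0 -> (a / b == 1) = (a == b).
Proof.
by move=> b0; apply/eqP/eqP=> [h|->]; [rewrite -(divfK b0 a) h mul1r | rewrite divff].
Qed.

Lemma sum_expr_unity (K : fieldType) n (x : K) :
  x ^+ n = 1 -> \sum_(i < n) x ^+ i = if x == 1 then n%:R else 0.
Proof.
move=> xn; case: eqP => [->|/eqP x1].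
  by under eq_bigr do rewrite expr1n; rewrite sumr_const card_ord.
apply: (mulfI (_ : x - 1 != 0)); first by rewrite subr_eq0.
by rewrite -subrX1 xn subrr mulr0.
Qed.

Section GroupAlgebraField.
Variables (K : fieldType) (gT : finGroupType).
Local Notation A := (grpalg K gT).

Lemma grpalgM (x y : A) t : (x * y) t = \sum_s x s * y (s^-1 * t)%g.
Proof. exact: ffunE. Qed.

Lemma grpalg1 t : (1 : A) t = (t == 1%g)%:R.
Proof. exact: ffunE. Qed.

Lemma grpalgZ a (x : A) t : (a *: x) t = a * x t.
Proof. exact: ffunE. Qed.

Lemma grpalg0 t : (0 : A) t = 0.
Proof. exact: ffunE. Qed.

Lemma grpalgB (x y : A) t : (x - y) t = x t - y t.
Proof. by apply: etrans (ffunE _ _) _; congr (_ + _); apply: ffunE. Qed.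

Lemma grpalg_sum I (r : seq I) (P : pred I) (E : I -> A) t :
  (\sum_(i <- r | P i) E i) t = \sum_(i <- r | P i) E i t.
Proof. exact: sum_ffunE. Qed.

Lemma gelt1 : gelt K (1%g : gT) = 1.
Proof. by []. Qed.

Lemma mulr_gelt (x : A) g t : (x * gelt K g) t = x (t * g^-1)%g.
Proof.
rewrite grpalgM (bigD1 (t * g^-1)%g) //= big1 => [|s st].
  by rewrite ffunE invMg invgK -mulgA mulVg mulg1 eqxx mulr1 addr0.
rewrite ffunE; case: eqP => [e|]; rewrite ?mulr0 // in st *.
by rewrite -e invMg invgK mulKVg eqxx in st.
Qed.

Lemma geltM (g h : gT) : gelt K (g * h)%g = gelt K g * gelt K h.
Proof.
apply/ffunP=> t; rewrite mulr_gelt !ffunE; congr (_ %:R).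
by rewrite (can2_eq (mulgKV h) (mulgK h)).
Qed.

Lemma gelt_inj : injective (@gelt K gT).
Proof.
move=> g h /ffunP/(_ g); rewrite !ffunE eqxx; case: eqP => // _ /eqP.
by rewrite oner_eq0.
Qed.

Lemma gscaleAl a (x y : A) : a *: (x * y) = (a *: x) * y.
Proof.
apply/ffunP=> t; rewrite grpalgZ !grpalgM mulr_sumr.
by apply: eq_bigr => s _; rewrite grpalgZ mulrA.
Qed.

Lemma gscaleAr a (x y : A) : a *: (x * y) = x * (a *: y).
Proof.
apply/ffunP=> t; rewrite grpalgZ !grpalgM mulr_sumr.
by apply: eq_bigr => s _; rewrite grpalgZ mulrCA.
Qed.

Lemma grpalg_expand (x : A) : x = \sum_t x t *: gelt K t.
Proof.
apply/ffunP=> t; rewrite grpalg_sum (bigD1 t) //= big1 => [|s st].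
  by rewrite grpalgZ ffunE eqxx mulr1 addr0.
by rewrite grpalgZ ffunE eq_sym (negbTE st) mulr0.
Qed.

Definition geval (chi : {ffun gT -> K}) (x : A) : K := \sum_t x t * chi t.

Lemma gevalM chi x y : is_character chi -> geval chi (x * y) = geval chi x * geval chi y.
Proof.
case/andP=> _ /forallP chiM; rewrite /geval mulr_suml.
under eq_bigr => t _ do rewrite grpalgM mulr_suml.
rewrite exchange_big /=; apply: eq_bigr => s _.
rewrite (reindex_inj (mulgI s)) /= mulr_sumr; apply: eq_bigr => t _.
by rewrite mulKg (eqP (forallP (chiM s) t)) mulrACA.
Qed.

Lemma geval_gelt chi g : geval chi (gelt K g) = chi g.
Proof.
rewrite /geval (bigD1 g) //= big1 ?ffunE ?eqxx ?mul1r ?addr0 // => t tg.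
by rewrite ffunE (negbTE tg) mul0r.
Qed.

Lemma geval_sum chi I (r : seq I) (P : pred I) (E : I -> A) :
  geval chi (\sum_(i <- r | P i) E i) = \sum_(i <- r | P i) geval chi (E i).
Proof.
rewrite /geval exchange_big /=; apply: eq_bigr => t _.
by rewrite grpalg_sum mulr_suml.
Qed.

Lemma gevalZ chi a (x : A) : geval chi (a *: x) = a * geval chi x.
Proof.
by rewrite /geval mulr_sumr; apply: eq_bigr => t _; rewrite grpalgZ mulrA.
Qed.

Lemma gevalB chi (x y : A) : geval chi (x - y) = geval chi x - geval chi y.
Proof.
rewrite /geval -sumrB; apply: eq_bigr => t _.
by rewrite grpalgB mulrBl.
Qed.

Section Idempotents.
Variables (n : nat) (z : K) (g : gT).
Hypotheses (z_prim : n.-primitive_root z) (gn : (g ^+ n = 1)%g).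

(* The idempotent of [K<g>] attached to the character [g |-> z ^+ k]. *)
Definition gidem (k : nat) : A :=
  n%:R^-1 *: \sum_(i < n) z^-1 ^+ (k * i) *: gelt K (g ^+ i)%g.

Let n0 : (n%:R : K) != 0 := prim_root_natf_neq0 z_prim.
Let z0 : z != 0.
Proof.
by apply/eqP=> z0; have := prim_expr_order z_prim; rewrite z0 expr0n
  gtn_eqF ?(prim_order_gt0 z_prim) // => /esym/eqP; rewrite oner_eq0.
Qed.

Lemma gidem_gelt k : gidem k * gelt K g = z ^+ k *: gidem k.
Proof.
rewrite /gidem -gscaleAl scalerA mulrC -scalerA; congr (_ *: _).
rewrite mulr_suml scaler_sumr.
pose f i := z ^+ k *: (z^-1 ^+ (k * i) *: gelt K (g ^+ i)%g).
transitivity (\sum_(i < n) f i.+1).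
  apply: eq_bigr => i _; rewrite -gscaleAl -geltM -expgSr /f scalerA; congr (_ *: _).
  by rewrite mulnS exprD mulrA -exprMn divff // expr1n mul1r.
apply: (sum_shift_periodic (f := f)).
by rewrite /f gn mulnC exprM exprVn (prim_expr_order z_prim) invr1 expr1n muln0.
Qed.

Lemma gidem_geltX k i : gidem k * gelt K (g ^+ i)%g = z ^+ (k * i) *: gidem k.
Proof.
elim: i => [|i IHi]; first by rewrite muln0 scale1r gelt1 mulr1.
by rewrite expgSr geltM mulrA IHi -gscaleAl gidem_gelt scalerA -exprD mulnSr.
Qed.

Lemma gidem_sum : \sum_(k < n) gidem k = 1.
Proof.
have npos := prim_order_gt0 z_prim.
rewrite -scaler_sumr exchange_big /=.
have e i : \sum_(k < n) z^-1 ^+ (k * i) *: gelt K (g ^+ i)%g =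
    (if (z^-1 ^+ i == 1) then n%:R else 0) *: gelt K (g ^+ i)%g.
  rewrite -scaler_suml -sum_expr_unity; last first.
    by rewrite exprAC exprVn (prim_expr_order z_prim) invr1 expr1n.
  by congr (_ *: _); apply: eq_bigr => k _; rewrite -exprM mulnC.
under eq_bigr => i _ do rewrite e.
rewrite (bigD1 (Ordinal npos)) //= expr0 eqxx big1 => [|i i0].
  by rewrite addr0 scalerA mulVf // scale1r.
rewrite exprVn invr_eq1 -(prim_order_dvd z_prim) gtnNdvd ?scale0r //.
by rewrite lt0n; apply: contraNneq i0 => i0; apply/eqP/val_inj.
Qed.

Lemma gidemM (k l : 'I_n) : gidem k * gidem l = if k == l then gidem k else 0.
Proof.
rewrite {2}/gidem -gscaleAr mulr_sumr.
transitivity ((n%:R^-1 * (\sum_(i < n) (z ^+ k / z ^+ l) ^+ i)) *: gidem k).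
  rewrite -scalerA scaler_suml; congr (_ *: _); apply: eq_bigr => i _.
  by rewrite -gscaleAr gidem_geltX scalerA mulrC exprMn -!exprM exprVn exprVn -exprM mulrC.
rewrite sum_expr_unity; last first.
  by rewrite exprMn exprVn ![_ ^+ _ ^+ n]exprAC (prim_expr_order z_prim) !expr1n divr1.
rewrite divf_eq1 ?expf_neq0 // (eq_prim_root_expr z_prim) !modn_small ?ltn_ord //.
rewrite (inj_eq val_inj).
by case: eqP => _; rewrite ?mulVf // ?scale1r // mulr0 scale0r.
Qed.

Lemma geval_gidem chi k : is_character chi ->
  geval chi (gidem k) = (chi g == z ^+ k)%:R.
Proof.
move=> chiP; have /andP[/eqP chi1 /forallP chiM] := chiP.
have chiX i : chi (g ^+ i)%g = chi g ^+ i.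
  elim: i => [|i IHi]; first exact: chi1.
  by rewrite expgS exprS -IHi; apply/eqP/(forallP (chiM g)).
rewrite gevalZ geval_sum.
under eq_bigr => i _ do rewrite gevalZ geval_gelt chiX exprM -exprMn.
rewrite sum_expr_unity; last first.
  by rewrite exprMn -chiX gn chi1 mulr1 exprAC exprVn (prim_expr_order z_prim) invr1 expr1n.
rewrite exprVn [(z ^+ k)^-1 * _]mulrC divf_eq1 ?expf_neq0 //.
by case: eqP => _; rewrite ?mulVf // mulr0.
Qed.

End Idempotents.

Section Abelian.
Hypothesis G_abelian : abelian [set: gT]%SET.

Lemma gmulC (x y : A) : x * y = y * x.
Proof.
have com (a b : gT) : (a * b = b * a)%g.
  by apply: (centsP G_abelian); rewrite inE.
apply/ffunP=> t; rewrite !grpalgM.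
rewrite (reindex_inj (@invg_inj gT)) (reindex_inj (mulIg t^-1%g)) /=.
apply: eq_bigr => s _; rewrite mulrC invgK mulgKV invMg invgK.
by rewrite com.
Qed.

(** If x <> 0, idempotents of cyclic subgroups multiply it to some y = x w <> 0 that is an
    eigenvector of every group element. The eigenvalues form a character l with y x' = l(x') y. Then
    l(x) = 0 gives y y = 0, hence l(y) = 0. But y(t) l(t) = y(1) for all t, so N y(1) = l(y) = 0 and
    y = 0, a contradiction. *)
Lemma char_separate N (z : K) (x : A) : N.-primitive_root z -> #|gT| = N ->
  (forall chi : dual gT K, geval chi x = 0) -> x = 0.
Proof.
move=> zP NE hx; apply/eqP; apply: contraT => x0.
have gN (g : gT) : (g ^+ N = 1)%g by rewrite -NE -cardsT expg_cardG ?inE.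
have eig (r : seq gT) : exists w, x * w != 0 /\
    forall g, g \in r -> exists c, x * w * gelt K g = c *: (x * w).
  elim: r => [|g r [w [xw0 hw]]]; first by exists 1; rewrite mulr1.
  have [k xwk] : exists k : 'I_N, x * w * gidem N z g k != 0.
    apply/existsP; apply: contraNT xw0 => /existsPn h.
    rewrite -[x * w]mulr1 -(gidem_sum g zP) mulr_sumr big1 // => k _.
    by have := h k; rewrite negbK => /eqP.
  exists (w * gidem N z g k); rewrite mulrA; split=> // t.
  rewrite inE => /predU1P[->|/hw[c cE]].
    by exists (z ^+ k); rewrite -mulrA gidem_gelt // gscaleAr.
  by exists c; rewrite -mulrA [_ * gelt K t]gmulC mulrA cE -gscaleAl.
have [w [xw0 hw]] := eig (enum gT).
have /choice[l lE] g : exists c, x * w * gelt K g = c *: (x * w).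
  by apply: hw; rewrite mem_enum.
set y := x * w in xw0 lE.
have yinj a b : a *: y = b *: y -> a = b.
  move/eqP; rewrite -subr_eq0 -scalerBl scaler_eq0 (negbTE xw0) orbF subr_eq0.
  by move/eqP.
have lM g h : l (g * h)%g = l g * l h.
  apply: yinj; rewrite -lE geltM mulrA lE -gscaleAl lE scalerA //.
have l1 : l 1%g = 1 by apply: yinj; rewrite -lE gelt1 mulr1 scale1r.
have lP : is_character [ffun g => l g].
  rewrite /is_character ffunE l1 eqxx /=.
  by apply/forallP=> g; apply/forallP=> h; rewrite !ffunE lM.
have ymul x' : y * x' = geval [ffun g => l g] x' *: y.
  rewrite {1}(grpalg_expand x') mulr_sumr scaler_suml; apply: eq_bigr => t _.
  by rewrite -gscaleAr lE scalerA ffunE.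
have yy : y * y = 0.
  by rewrite {2}/y mulrA ymul (hx (Dual lP)) scale0r mul0r.
have yt t : y t * l t = y 1%g.
  have := congr1 (fun f : A => f 1%g) (lE t^-1%g).
  rewrite mulr_gelt grpalgZ invgK mul1g => ->.
  by rewrite mulrAC -lM mulVg l1 mul1r.
have : geval [ffun g => l g] y = 0.
  by apply: yinj; rewrite -ymul yy scale0r.
rewrite /geval (eq_bigr (fun=> y 1%g)) => [|t _]; last first.
  by rewrite -(yt t); congr (_ * _); rewrite ffunE.
rewrite sumr_const NE -mulr_natr => /eqP.
rewrite mulf_eq0 (negbTE (prim_root_natf_neq0 zP)) orbF => /eqP y1.
case/eqP: xw0; apply/ffunP=> t; rewrite grpalg0.
have lt0 : l t != 0.
  by apply/eqP=> lt0; have := lM t t^-1%g; rewrite mulgV l1 lt0 mul0r => /eqP; rewrite oner_eq0.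
by apply: (mulIf lt0); rewrite yt y1 mul0r.
Qed.

Fact dualM_proof (chi chi' : dual gT K) :
  is_character [ffun t => chi t * chi' t].
Proof.
have [/andP[/eqP c1 /forallP cM] /andP[/eqP c1' /forallP cM']] := (valP chi, valP chi').
rewrite /is_character ffunE [chi _]c1 [chi' _]c1' mulr1 eqxx /=.
apply/forallP=> g; apply/forallP=> h; rewrite !ffunE.
by rewrite [chi _](eqP (forallP (cM g) h)) [chi' _](eqP (forallP (cM' g) h)) mulrACA.
Qed.

Definition dualM chi chi' : dual gT K := Dual (dualM_proof chi chi').

Lemma dualP (chi : dual gT K) : is_character chi.
Proof. exact: valP. Qed.

(** For fixed chi' the elements t |-> x(t) chi'(t) and chi'(x) x have the same value under every
    character, hence are equal. At a point t with x(t) <> 0 this gives chi'(x) = chi'(t) for all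
    chi'. *)
Lemma group_like_gelt N (z : K) (x : A) : N.-primitive_root z -> #|gT| = N ->
  x != 0 ->
  (forall chi chi' : dual gT K, geval chi x * geval chi' x = geval (dualM chi chi') x) ->
  exists g, x = gelt K g.
Proof.
move=> zP NE x0 hx.
have xt t (chi' : dual gT K) : x t * chi' t = geval chi' x * x t.
  pose xc : A := [ffun t => x t * chi' t].
  suff : xc - geval chi' x *: x = 0.
    move=> /ffunP/(_ t) /eqP; rewrite grpalgB grpalg0 grpalgZ ffunE.
    by rewrite subr_eq0 => /eqP.
  apply: (char_separate zP NE) => chi.
  rewrite gevalB gevalZ mulrC hx; apply/eqP; rewrite subr_eq0; apply/eqP.
  by apply: eq_bigr => g _; rewrite !ffunE mulrA mulrAC.
have [t xt0] : exists t, x t != 0.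
  apply/existsP; apply: contraNT x0 => /existsPn h; apply/eqP/ffunP=> t.
  by rewrite grpalg0; have := h t; rewrite negbK => /eqP.
exists t; apply/eqP; rewrite -subr_eq0; apply/eqP/(char_separate zP NE) => chi.
by rewrite gevalB geval_gelt -(mulfK xt0 (geval chi x)) -xt mulrC mulKf // subrr.
Qed.

End Abelian.

End GroupAlgebraField.

(** * Multiplicative functions on formal sums of characters *)

Section DualProducts.
Variables (K : fieldType) (gT : finGroupType).
Local Notation Zdual := {freeg (dual gT K) / int}.

(** Common form of [dual_prod] and [rag], which are both convertible to an instance of it. *)
Definition zdual_prod (f : dual gT K -> K) (psi : Zdual) : K :=
  \prod_(chi <- dom psi) f chi ^ coeff chi psi.

Lemma zdual_prod_wide f (psi : Zdual) (r : seq (dual gT K)) :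
  uniq r -> {subset dom psi <= r} ->
  zdual_prod f psi = \prod_(chi <- r) f chi ^ coeff chi psi.
Proof.
move=> ur sr; rewrite (bigID (mem (dom psi))) /= [X in _ * X]big1 => [|chi]; last first.
  by move=> /coeff_outdom ->; rewrite expr0z.
rewrite mulr1 -big_filter; apply: perm_big; apply: uniq_perm.
- exact: uniq_dom.
- exact: filter_uniq.
by move=> chi; rewrite mem_filter; case: (boolP (chi \in dom psi)) => // /sr ->.
Qed.

Lemma zdual_prodD f (psi psi' : Zdual) : (forall chi, f chi != 0) ->
  zdual_prod f (psi + psi') = zdual_prod f psi * zdual_prod f psi'.
Proof.
move=> f0; pose r := undup (dom psi ++ dom psi').
have ur : uniq r by apply: undup_uniq.
rewrite !(@zdual_prod_wide f _ r) //; last 3 first.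
- by move=> chi h; rewrite mem_undup mem_cat h orbT.
- by move=> chi h; rewrite mem_undup mem_cat h.
- by move=> chi h; rewrite mem_undup; apply: domD_subset h.
by rewrite -big_split; apply: eq_bigr => chi _; rewrite coeffD expfzDr.
Qed.

Lemma zdual_prodU f k chi : k != 0 -> zdual_prod f (<< k *g chi >> : Zdual) = f chi ^ k.
Proof. by move=> k0; rewrite /zdual_prod domU // big_seq1 coeffU eqxx mulr1. Qed.

Lemma zdual_prod_dual_relation f (chi chi' : dual gT K) : (forall chi, f chi != 0) ->
  zdual_prod f (<< 1 *g chi >> + << 1 *g chi' >> + << -1 *g dualM chi chi' >>)
  = f chi * f chi' / f (dualM chi chi').
Proof. by move=> f0; rewrite !zdual_prodD // !zdual_prodU // !expr1z. Qed.

Lemma dual_neq0 (chi : dual gT K) s : chi s != 0.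
Proof.
have /andP[/eqP c1 /forallP/(_ s)/forallP/(_ s^-1%g)] := valP chi.
rewrite mulgV c1 => /eqP h; apply/eqP=> s0.
by have /eqP := h; rewrite [val chi s]s0 mul0r oner_eq0.
Qed.

(** The relations chi + chi' - chi chi' belong to [A_dual]. Triviality of [x] on them says that chi
    |-> chi(x) is multiplicative, so [x] is group-like. *)
Lemma rag_trivial_gelt N (z : K) (x : grpalg K gT) : abelian [set: gT]%SET ->
  N.-primitive_root z -> #|gT| = N ->
  (forall chi : dual gT K, geval chi x != 0) ->
  (forall psi : Zdual, A_dual psi -> rag x psi = 1) ->
  exists g, x = gelt K g.
Proof.
move=> Gab zP NE x0 hx; apply: (group_like_gelt Gab zP NE).
  have c1 : is_character [ffun _ : gT => 1 : K].
    rewrite /is_character ffunE eqxx /=; apply/forallP=> g; apply/forallP=> h.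
    by rewrite !ffunE mulr1.
  apply: contraNneq (x0 (Dual c1)) => ->; rewrite /geval big1 // => t _.
  by rewrite grpalg0 mul0r.
move=> chi chi'; have := hx (<< 1 *g chi >> + << 1 *g chi' >> + << -1 *g dualM chi chi' >>).
rewrite -[rag _ _]/(zdual_prod (fun chi : dual gT K => geval chi x) _).
rewrite zdual_prod_dual_relation // => h.
have {}/h h : A_dual (<< 1 *g chi >> + << 1 *g chi' >> + << -1 *g dualM chi chi' >>).
  move=> s; rewrite -[dual_prod _ _]/(zdual_prod (fun chi : dual gT K => chi s) _).
  rewrite zdual_prod_dual_relation => [|c]; last exact: dual_neq0.
  by rewrite [dualM chi chi' s]ffunE divff // mulf_neq0 // dual_neq0.
by rewrite -(divfK (x0 (dualM chi chi')) (_ * _)) h mul1r.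
Qed.

End DualProducts.

(** * The valuation ring of the algebraic closure *)

Section ZpRing.
Variables (p : nat) (K : fieldType) (nrm : K -> rat).
Hypothesis KP : is_Qp p nrm.

(* The proof [KP] is a parameter so that the ring structure can be inferred. *)
Definition Zp_int of is_Qp p nrm : {pred K} := [pred x | nrm x <= 1].

Lemma Zp_intE x : (x \in Zp_int KP) = (nrm x <= 1).
Proof. by []. Qed.

Fact Zp_int_subring : subring_closed (Zp_int KP).
Proof.
split=> [|x y|x y]; rewrite !Zp_intE ?(Qp_norm1 KP) //; first exact: (Qp_normB_le KP).
by move=> hx hy; rewrite (Qp_normM KP) mulr_ile1 ?(Qp_norm_ge0 KP).
Qed.

HB.instance Definition _ :=
  GRing.isSubringClosed.Build K (Zp_int KP) Zp_int_subring.

Record Zp_type := ZpElt { Zp_val :> K; _ : Zp_val \in Zp_int KP }.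
HB.instance Definition _ := [isSub for Zp_val].
HB.instance Definition _ := [Choice of Zp_type by <:].
HB.instance Definition _ := [SubChoice_isSubComNzRing of Zp_type by <:].

Lemma Zp_poly_lift (P : {poly K}) : gauss_le nrm 1 P ->
  exists Q : {poly Zp_type}, map_poly val Q = P.
Proof.
move=> hP; exists (map_poly (insubd (0 : Zp_type)) P); apply/polyP=> i.
rewrite coef_map coef_map_id0 /=; last by apply/val_inj; rewrite val_insubd rpred0.
by rewrite val_insubd Zp_intE hP.
Qed.

End ZpRing.

Section LocalFieldIntegers.
Variables (p : nat) (Qp : fieldType) (absp : Qp -> rat).
Hypothesis QpP : is_Qp p absp.
Variables (F : fieldExtType Qp) (Fc : closedFieldType).
Variable (iota : {rmorphism F -> Fc}).
Hypothesis Fc_alg : forall x : Fc, algebraicOver iota x.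

Local Notation jQ := (iota \o in_alg F).
Local Notation O := (OFc absp iota).
Local Notation jZ := (jQ \o (val : Zp_type QpP -> Qp)).

Lemma OFc_integral x : O x <-> integralOver jZ x.
Proof.
split=> [[P [mP hP rP]]|[P mP rP]].
  have [Q QP] := Zp_poly_lift QpP hP; exists Q; last first.
    by rewrite (map_poly_comp jQ) QP.
  have inj : injective (val : Zp_type QpP -> Qp) by exact: val_inj.
  rewrite monicE -(inj_eq inj) -(lead_coef_map_inj inj) ?rmorph0 //.
  by rewrite QP (monicP mP) rmorph1.
exists (map_poly (val : Zp_type QpP -> Qp) P); split.
- exact: monic_map.
- by move=> i; rewrite coef_map /= -(Zp_intE QpP); apply: valP.
- by rewrite -map_poly_comp.
Qed.

Lemma OFcB x y : O x -> O y -> O (x - y).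
Proof. by move=> /OFc_integral hx /OFc_integral hy; apply/OFc_integral/integral_sub. Qed.

Lemma OFcM x y : O x -> O y -> O (x * y).
Proof. by move=> /OFc_integral hx /OFc_integral hy; apply/OFc_integral/integral_mul. Qed.

Lemma OFc1 : O 1.
Proof. exact/OFc_integral/integral1. Qed.

(** Z_p is integrally closed: for |c| > 1 the leading term of a monic integral relation is strictly
    larger than all the others. *)
Lemma OFc_Qp c : O (jQ c) <-> absp c <= 1.
Proof.
split=> [[P [mP hP]]|hc]; last first.
  exists ('X - c%:P); split; rewrite ?monicXsubC ?rmorph_root ?root_XsubC //.
  move=> i; rewrite coefB coefX coefC (Qp_normB_le QpP) //; case: eqP => _ //;
    by rewrite ?(Qp_norm1 QpP) ?(Qp_norm0 QpP).
rewrite fmorph_root => rP; rewrite leNgt; apply/negP=> c1.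
have c0 : 0 < absp c by apply: lt_trans c1.
have szP : size P = (size P).-1.+1 by rewrite prednK // size_poly_gt0 monic_neq0.
move: rP; rewrite /root horner_coef szP big_ord_recr /= -lead_coefE (monicP mP) mul1r.
rewrite addrC addr_eq0 => /eqP e.
have absX n : absp (c ^+ n) = absp c ^+ n.
  by elim: n => [|n IHn]; rewrite ?(Qp_norm1 QpP) // !exprS (Qp_normM QpP) IHn.
have cpos n : 0 <= absp c ^+ n by rewrite exprn_ge0 // ltW.
have : absp (c ^+ (size P).-1) < absp c ^+ (size P).-1.
  case en : (size P).-1 e => [|n] ->.
    by rewrite big_ord0 oppr0 (Qp_norm0 QpP).
  rewrite (Qp_normN QpP); apply: le_lt_trans (_ : absp c ^+ n < _); last first.
    by rewrite exprS ltr_pMl // exprn_gt0.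
  apply: (Qp_norm_sum_le QpP) => // i _; rewrite (Qp_normM QpP) -[leRHS]mul1r absX.
  by rewrite ler_pM ?(Qp_norm_ge0 QpP) // ler_weXn2l // ?ltW // -ltnS.
by rewrite absX ltxx.
Qed.

Lemma Qp_algebraic x : algebraicOver jQ x.
Proof.
apply/integral_algebraic; have /integral_algebraic[P mP rP] := Fc_alg x.
apply: integral_root_monic (monic_map iota mP) rP _.
apply/integral_poly=> i; rewrite coef_map /=; move: (P`_i) => c.
have [/polyOver1P[Q QE] mQ] := (minPolyOver 1 c, monic_minPoly 1 c).
apply/integral_algebraic; exists Q; first by rewrite -(map_poly_eq0 (in_alg F)) -QE monic_neq0.
by rewrite map_poly_comp -QE fmorph_root root_minPoly.
Qed.

(** A polynomial killing [x] is scaled to Gauss norm 1 with coefficient 1 at [r]. If [r] is the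
    degree, [x] is integral; if [r = 0], the reversed polynomial is monic and kills [x^-1].
    Otherwise Hensel's lemma splits the polynomial, and the induction goes on with a factor that
    kills [x]. *)
Lemma OFc_total x : O x \/ O x^-1.
Proof.
have [P P0 rP] := Qp_algebraic x.
have [n] := ubnP (size P); elim: n P P0 rP => // n IH P P0 rP /ltnSE sP.
have [->|x0] := eqVneq x 0; first by left; rewrite -(rmorph0 jQ) OFc_Qp (Qp_norm0 QpP).
have szP : (0 < size P)%N by rewrite size_poly_gt0.
pose i1 := [arg max_(i > Ordinal szP) absp P`_i]%O.
have hi1 i : absp P`_i <= absp P`_i1.
  rewrite /i1; case: Order.TotalTheory.arg_maxP => //= j _ hj.
  case: (ltnP i (size P)) => [si|si]; first exact: (hj (Ordinal si)).
  by rewrite nth_default // (Qp_norm0 QpP) (Qp_norm_ge0 QpP).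
have C0 : 0 < absp P`_i1.
  apply: lt_le_trans (hi1 (size P).-1).
  by rewrite lt_def (Qp_norm_ge0 QpP) (Qp_norm_eq0P QpP) lead_coef_eq0 P0.
(* [r] is the last index of maximal norm, so that all later coefficients of [f] have norm below
   1. *)
pose R i := (i < size P)%N && (absp P`_i == absp P`_i1).
have Rex : exists i, R i by exists i1; rewrite /R ltn_ord eqxx.
have Rbd i : R i -> (i <= size P)%N by case/andP=> /ltnW.
case: (ex_maxnP Rex Rbd) => r /andP[rs /eqP rC] rmax.
have Pr0 : P`_r != 0 by rewrite -(Qp_norm_eq0P QpP) rC gt_eqF.
pose f := (P`_r)^-1 *: P.
have fE i : absp f`_i = absp P`_i / absp P`_i1.
  by rewrite coefZ (Qp_normM QpP) (Qp_normV QpP) rC mulrC.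
have f1 : gauss_le absp 1 f by move=> i; rewrite fE ler_pdivrMr // mul1r.
have fr : f`_r = 1 by rewrite coefZ mulVf.
have fi i : (r < i)%N -> absp f`_i < 1.
  move=> ri; rewrite fE ltr_pdivrMr // mul1r lt_neqAle hi1 andbT.
  apply/negP=> /eqP e; have [si|si] := ltnP i (size P).
    by have := rmax i; rewrite /R si e eqxx => /(_ isT); rewrite leqNgt ri.
  by move: e C0; rewrite nth_default // (Qp_norm0 QpP) => <-; rewrite ltxx.
have sf : size f = size P by rewrite size_scale // invr_eq0.
have f0 : f != 0 by rewrite -size_poly_gt0 sf.
have rf : root (map_poly jQ f) x by rewrite map_polyZ rootE hornerZ (rootP rP) mulr0.
have [re|re] := eqVneq r.+1 (size P).
  left; exists f; split=> //.
  by rewrite monicE lead_coefE sf -re fr.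
case: r => [|r] in rs rC rmax Pr0 f fE f1 fr fi sf f0 rf re *; last first.
  have [|g [h [fgh sg1 sgf]]] := hensel_factor QpP f1 fr (ltn0Sn r) _ fi.
    by rewrite sf ltn_neqAle re.
  have /norP[g0 h0] : ~~ ((g == 0) || (h == 0)) by rewrite -mulf_eq0 -fgh.
  move: rf; rewrite fgh rmorphM rootM => /orP[rg|rh].
    by apply: (IH g) => //; apply: leq_trans sgf _; rewrite sf.
  apply: (IH h) => //; apply: leq_trans sP; rewrite -sf fgh size_mul //.
  have aux a b : (1 < a)%N -> (b < (a + b).-1)%N by lia.
  exact: aux.
right; pose Q := Poly (rev f).
have QE i : (i < size f)%N -> Q`_i = f`_(size f - i.+1).
  by move=> si; rewrite coef_Poly nth_rev.
have Qd i : (size f <= i)%N -> Q`_i = 0.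
  by move=> si; rewrite coef_Poly nth_default // size_rev.
have Ql : Q`_(size f).-1 = 1.
  by rewrite QE prednK ?subnn // ?sf // leqnn.
have sQ : size Q = size f.
  apply/eqP; rewrite eqn_leq; apply/andP; split; first by apply/leq_sizeP/Qd.
  rewrite leqNgt; apply/negP => h; move/eqP: Ql; rewrite nth_default.
    by rewrite eq_sym oner_eq0.
  by rewrite -ltnS (ltn_predK h).
exists Q; split.
- by rewrite monicE lead_coefE sQ Ql.
- move=> i; case: (ltnP i (size f)) => hi; first by rewrite QE.
  by rewrite Qd // (Qp_norm0 QpP).
have xn : x ^+ (size f).-1 != 0 by rewrite expf_neq0.
rewrite rootE -(inj_eq (mulfI xn)) mulr0 -(rootP rf).
rewrite (@horner_coef_wide _ (size f)) ?size_map_poly ?sQ //.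
rewrite horner_coef mulr_sumr size_map_poly [X in _ == X](reindex_inj rev_ord_inj) /=.
apply/eqP/eq_bigr => i _; rewrite !coef_map QE //= mulrCA.
congr (_ * _); rewrite -{1}(subnKC (valP i)) addSn addnC exprD exprVn mulfK //.
exact: expf_neq0.
Qed.

(* The maximal ideal of [O]; the first alternative is there because [0^-1 = 0]. *)
Definition maxO (x : Fc) := x = 0 \/ ~ O x^-1.

Lemma OFc0 : O 0.
Proof. by have := OFcB OFc1 OFc1; rewrite subrr. Qed.

Lemma OFcN x : O x -> O (- x).
Proof. by rewrite -sub0r; apply: OFcB OFc0. Qed.

Lemma OFcD x y : O x -> O y -> O (x + y).
Proof. by move=> hx /OFcN /(OFcB hx); rewrite opprK. Qed.

Lemma OFcX x n : O x -> O (x ^+ n).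
Proof.
by move=> hx; elim: n => [|n IHn]; [exact: OFc1 | rewrite exprS; apply: OFcM].
Qed.

Lemma OFc_sum I (r : seq I) (P : pred I) (E : I -> Fc) :
  (forall i, P i -> O (E i)) -> O (\sum_(i <- r | P i) E i).
Proof. by move=> h; elim/big_ind: _ => //; [exact: OFc0 | exact: OFcD]. Qed.

Lemma OFc_nat n : O n%:R.
Proof.
elim: n => [|n IHn]; first exact: OFc0.
by rewrite -natr1; apply: OFcD IHn OFc1.
Qed.

Lemma OFc_root x n : (0 < n)%N -> O (x ^+ n) -> O x.
Proof.
move=> n0 hxn; case: (OFc_total x) => // hx.
have [->|x0] := eqVneq x 0; first exact: OFc0.
have -> : x = x ^+ n * x^-1 ^+ n.-1.
  rewrite -{1}(prednK n0) exprSr exprVn mulrAC divff ?mul1r //.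
  exact: expf_neq0.
by apply: OFcM => //; apply: OFcX.
Qed.

Lemma maxO0 : maxO 0. Proof. by left. Qed.

Lemma maxO_OFc x : maxO x -> O x.
Proof. by case=> [->|h]; [apply: OFc0 | case: (OFc_total x)]. Qed.

Lemma maxOPn x : ~ maxO x -> x != 0 /\ O x^-1.
Proof.
by move=> h; split; [apply/eqP=> x0; apply: h; left | apply: contrapT => h'; apply: h; right].
Qed.

Lemma maxO_unit x : O x^-1 -> maxO x -> x = 0.
Proof. by move=> h []. Qed.

Lemma maxO1 : ~ maxO 1.
Proof. by case=> [/eqP|]; rewrite ?oner_eq0 // invr1 => /(_ OFc1). Qed.

Lemma maxOMl x y : O x -> maxO y -> maxO (x * y).
Proof.
have [->|x0] := eqVneq x 0; first by rewrite mul0r => *; left.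
move=> hx [->|hy]; first by rewrite mulr0; left.
by right=> h; apply: hy; have := OFcM hx h; rewrite invfM mulrA divff ?mul1r.
Qed.

Lemma maxOMr x y : maxO x -> O y -> maxO (x * y).
Proof. by move=> hx hy; rewrite mulrC; apply: maxOMl. Qed.

Lemma maxOD x y : maxO x -> maxO y -> maxO (x + y).
Proof.
have [->|x0] := eqVneq x 0; first by rewrite add0r.
have [->|y0] := eqVneq y 0; first by rewrite addr0.
move=> hx hy; case: (OFc_total (x / y)) => h.
  have -> : x + y = (x / y + 1) * y by rewrite mulrDl mul1r divfK.
  by apply: maxOMl hy; apply: OFcD h OFc1.
have -> : x + y = (1 + y / x) * x by rewrite mulrDl mul1r divfK.
by apply: maxOMl hx; apply: OFcD OFc1 _; rewrite -invf_div.
Qed.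

Lemma maxON x : maxO x -> maxO (- x).
Proof. by rewrite -mulN1r; apply/maxOMl/OFcN/OFc1. Qed.

Lemma maxOB x y : maxO x -> maxO y -> maxO (x - y).
Proof. by move=> hx /maxON; apply: maxOD. Qed.

Lemma maxO_sum I (r : seq I) (P : pred I) (E : I -> Fc) :
  (forall i, P i -> maxO (E i)) -> maxO (\sum_(i <- r | P i) E i).
Proof. by move=> h; elim/big_ind: _ => //; [exact: maxO0 | exact: maxOD]. Qed.

Lemma maxO_prime x y : maxO (x * y) -> maxO x \/ maxO y.
Proof.
move=> hxy; apply: contrapT => /not_orP[/maxOPn[x0 hx] hy]; apply: hy.
by rewrite -(mulKf x0 y); apply: maxOMl.
Qed.

Lemma maxO_prod I (r : seq I) (E : I -> Fc) :
  maxO (\prod_(i <- r) E i) -> exists i, maxO (E i).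
Proof.
elim: r => [|i r IH]; first by rewrite big_nil => /maxO1.
by rewrite big_cons => /maxO_prime[h|/IH//]; exists i.
Qed.

Lemma maxO_X x n : maxO (x ^+ n) -> maxO x.
Proof.
elim: n => [/maxO1//|n IHn]; rewrite exprS => /maxO_prime[//|]; exact: IHn.
Qed.


(** * Galois action and congruences modulo the maximal ideal *)

Local Notation absgal := (absgal iota).

Lemma absgal_OFc (w : absgal) x : O (w x) <-> O x.
Proof.
have e (P : {poly Qp}) : map_poly w (map_poly jQ P) = map_poly jQ P.
  by rewrite -map_poly_comp; apply: eq_map_poly => c /=; apply: absgal_fix.
split=> -[P [mP hP rP]]; exists P; split=> //.
  by move: rP; rewrite -{1}e fmorph_root.
by rewrite -e fmorph_root.
Qed.

Lemma absgal_maxO (w : absgal) x : maxO x -> maxO (w x).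
Proof.
case=> [->|hx]; first by rewrite rmorph0; left.
by right; rewrite -fmorphV absgal_OFc.
Qed.

Lemma absgal_inv (w : absgal) : exists w' : absgal, cancel w w' /\ cancel w' w.
Proof.
have [g wK gK] := absgal_bij w.
have gB : zmod_morphism g.
  by move=> x y; apply: (can_inj wK); rewrite rmorphB !gK.
have gM : monoid_morphism g.
  by split=> [|x y]; apply: (can_inj wK); rewrite ?rmorph1 ?rmorphM !gK.
pose g' : {rmorphism Fc -> Fc} := HB.pack g (GRing.isZmodMorphism.Build _ _ g gB)
  (GRing.isMonoidMorphism.Build _ _ g gM).
have gF c : g' (iota c) = iota c by rewrite /g' /= -{1}(absgal_fix w c) wK.
by exists (@AbsGal _ _ _ iota g' (Bijective gK wK) gF).
Qed.

Section CharZero.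
Hypothesis Fc_char0 : forall n, n.+1%:R != 0 :> Fc.

Lemma absgal_fixed y : (forall w : absgal, w y = y) -> exists c, y = iota c.
Proof.
move=> hy; apply: contrapT => /forallNP yF.
have [|w [wF wy]] := moved_by_endomorphism Fc_alg Fc_char0 (y := y).
  by move=> c; apply/eqP.
have := hy (AbsGal (endomorphism_bij Fc_alg wF) wF) => /= e.
by rewrite e eqxx in wy.
Qed.

End CharZero.

Lemma cong_prod I (r : seq I) (P : pred I) (a b : I -> Fc) :
  (forall i, P i -> O (a i)) -> (forall i, P i -> O (b i)) ->
  (forall i, P i -> maxO (a i - b i)) ->
  maxO (\prod_(i <- r | P i) a i - \prod_(i <- r | P i) b i).
Proof.
move=> ha hb hab.
suff [] : [/\ maxO (\prod_(i <- r | P i) a i - \prod_(i <- r | P i) b i),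
  O (\prod_(i <- r | P i) a i) & O (\prod_(i <- r | P i) b i)] by [].
elim/big_rec2: _ => [|i x y Pi [hxy hx hy]].
  by rewrite subrr; split; [left | exact: OFc1 | exact: OFc1].
split; [|by apply: OFcM => //; auto|by apply: OFcM => //; auto].
have -> : a i * y - b i * x = a i * (y - x) + (a i - b i) * x by ring.
by apply: maxOD; [apply: maxOMl; auto | apply: maxOMr; auto].
Qed.

Lemma cong_exp x y n : O x -> O y -> maxO (x - y) -> maxO (x ^+ n - y ^+ n).
Proof.
move=> hx hy hxy; have e (a : Fc) : a ^+ n = \prod_(i < n) a.
  by rewrite prodr_const card_ord.
by rewrite !e; apply: cong_prod.
Qed.

(** For x <> 1 the sum of the x^i, i < n, is 0; but it is congruent to n. *)
Lemma unity_cong1 n x : (0 < n)%N -> ~ maxO n%:R -> x ^+ n = 1 -> maxO (x - 1) -> x = 1.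
Proof.
move=> n0 nu xn hx; apply/eqP; apply: contraT => x1; exfalso; apply: nu.
have xO : O x by apply: (OFc_root n0); rewrite xn; apply: OFc1.
have := sum_expr_unity xn; rewrite (negbTE x1) => s0.
rewrite -[n%:R]opprK; apply: maxON; rewrite -[- _]add0r -s0.
rewrite -[in n%:R](card_ord n) -sumr_const -sumrB; apply: maxO_sum => i _.
by rewrite -(expr1n Fc i); apply: cong_exp => //; apply: OFc1.
Qed.

Lemma unity_cong n x y : (0 < n)%N -> ~ maxO n%:R -> x ^+ n = 1 -> y ^+ n = 1 ->
  maxO (x - y) -> x = y.
Proof.
move=> n0 nu xn yn hxy.
have y0 : y != 0.
  by apply: contra_eq_neq yn => ->; rewrite expr0n gtn_eqF // eq_sym oner_neq0.
have yO : O y^-1 by apply: (OFc_root n0); rewrite exprVn yn invr1; apply: OFc1.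
have h1 : x / y = 1.
  apply: (unity_cong1 n0 nu); first by rewrite exprMn exprVn xn yn divr1.
  by have := maxOMr hxy yO; rewrite mulrBl divff.
by rewrite -(divfK y0 x) h1 mul1r.
Qed.

Lemma cong_unity_root n (z x : Fc) : n.-primitive_root z -> maxO (x ^+ n - 1) ->
  exists i : 'I_n, maxO (x - z ^+ i).
Proof.
move=> zP; rewrite -[x ^+ n - 1](_ : ('X^n - 1).[x] = _); last by rewrite !hornerE.
rewrite -(factor_Xn_sub_1 zP) horner_prod big_mkord => /maxO_prod[i].
by rewrite hornerXsubC; exists i.
Qed.

Lemma p_maxO : prime p -> maxO p%:R.
Proof.
move=> p_prime; right; rewrite -[p%:R^-1](_ : jQ p%:R^-1 = _); last first.
  by rewrite fmorphV rmorph_nat.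
rewrite OFc_Qp (Qp_normV QpP) -[p%:R](ratr_nat Qp p) (Qp_norm_ratr QpP) /padic_norm.
have pr : prime p := p_prime.
rewrite pnatr_eq0 -leqn0 leqNgt prime_gt0 //=.
have -> : numq (p%:R : rat) = p%:Z by rewrite -[p%:R]/(p%:~R) numq_int.
have -> : denq (p%:R : rat) = 1 by rewrite -[p%:R]/(p%:~R) denq_int.
have -> : logn p `|p%:Z| = 1%N by rewrite absz_nat logn_prime // eqxx.
rewrite logn1 sub0r exprN1 invrK.
by apply/negP; rewrite -ltNge (ltr_nat _ 1 p) prime_gt1.
Qed.

Lemma coprime_not_maxO n : prime p -> coprime n p -> ~ maxO n%:R.
Proof.
move=> p_prime np hn; have pp := p_maxO p_prime.
have p0 : (0 < p)%N := prime_gt0 p_prime.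
have [a b e _] := egcdnP n p0; move: e; rewrite gcdnC (eqP np) => e.
apply: maxO1; have -> : 1 = a%:R * p%:R - b%:R * n%:R :> Fc.
  by rewrite -!natrM e natrD [X in _ + X - _]/1%:R addrAC subrr add0r.
by apply: maxOB; apply: maxOMl => //; apply: OFc_nat.
Qed.

(** * Residues and roots of unity *)

Section Uniformizer.
Variables (pi : F) (q : nat).
Hypothesis pi_unif : is_uniformizer absp iota (range iota) (iota pi).
Hypothesis q_card : is_residue_card absp iota pi q.

Lemma pi_neq0 : iota pi != 0.
Proof. by case: pi_unif. Qed.

Lemma pi_OFc : O (iota pi).
Proof. by case: pi_unif => _ [_]. Qed.

Lemma pi_maxO : maxO (iota pi).
Proof.
case: pi_unif => p0 hO nU _; right=> h; apply: nU; split=> //; split=> //.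
by exists pi^-1; rewrite ?fmorphV.
Qed.

Lemma pi_divides c : maxO (iota c) -> O (iota c / iota pi).
Proof.
move=> hc; case: pi_unif => p0 _ _ h.
have [] // := h (iota c); first by split; [exists c | exact: maxO_OFc].
case=> c0 _ [_ hV]; case: hc => // e; by rewrite e eqxx in c0.
Qed.

Lemma pi_divides_lt c : maxO (iota c * iota pi) -> O (iota c).
Proof.
by rewrite -rmorphM => /pi_divides; rewrite rmorphM mulfK // pi_neq0.
Qed.

Section Residues.
Variable r : 'I_q -> F.
Hypothesis r_int : forall i, OF absp iota (r i).
Hypothesis r_rep : forall x, OF absp iota x -> exists! i, OF absp iota ((x - r i) / pi).

Lemma rep_congP (x : F) i :
  OF absp iota ((x - r i) / pi) <-> maxO (iota x - iota (r i)).
Proof.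
rewrite /OF /= fmorph_div rmorphB; split=> h; last first.
  by rewrite -rmorphB; apply: pi_divides; rewrite rmorphB.
by rewrite -(divfK pi_neq0 (_ - _)); apply: maxOMl => //; apply: pi_maxO.
Qed.

Lemma rep_exists x : O (iota x) -> exists i, maxO (iota x - iota (r i)).
Proof. by move=> /r_rep[i [/rep_congP hi _]]; exists i. Qed.

Lemma rep_inj i j : maxO (iota (r i) - iota (r j)) -> i = j.
Proof.
move=> hij; have [k [_ hk]] := r_rep (r_int i).
by rewrite -(hk i) -1?(hk j) //; apply/rep_congP; rewrite ?subrr //; left.
Qed.

Lemma residue_card_gt1 : (1 < q)%N.
Proof.
have [|i hi] := rep_exists (x := 0); first by rewrite rmorph0; apply: OFc0.
have [|j hj] := rep_exists (x := 1); first by rewrite rmorph1; apply: OFc1.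
have ij : i != j.
  apply/eqP=> ij; apply: maxO1; rewrite -[1](_ : iota 1 - iota (r j) - (iota 0 - iota (r i)) = _).
    by apply: maxOB.
  by rewrite ij rmorph0 rmorph1; ring.
rewrite ltnNge; apply/negP=> q1; case/eqP: ij; apply/val_inj.
by move: (ltn_ord i) (ltn_ord j) q1 => /=; lia.
Qed.

(** Adding 1 permutes the residue classes. The sum of r(i) + 1 - r(f(i)) over all classes is
    therefore q, and every term lies in the maximal ideal. *)
Lemma residue_card_maxO : maxO q%:R.
Proof.
have /choice[f hf] i : exists j, maxO (iota (r i + 1) - iota (r j)).
  by apply: rep_exists; rewrite rmorphD rmorph1; apply: OFcD OFc1; apply: r_int.
have f_inj : injective f.
  move=> i j fij; apply: rep_inj.
  rewrite -[_ - _](_ : iota (r i + 1) - iota (r (f i)) - (iota (r j + 1) - iota (r (f j))) = _).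
    exact: maxOB.
  by rewrite fij !rmorphD; ring.
have -> : q%:R = \sum_i (iota (r i + 1) - iota (r (f i))).
  rewrite sumrB -(reindex_inj f_inj (P := xpredT) (F := fun i => iota (r i))) -sumrB.
  under eq_bigr => i _ do rewrite rmorphD addrAC subrr add0r rmorph1.
  by rewrite sumr_const card_ord.
by apply: maxO_sum.
Qed.

Lemma dvd_residue_card_not_maxO n : (n %| q.-1)%N -> ~ maxO n%:R.
Proof.
case/dvdnP=> k qk hn; apply: maxO1.
have -> : 1 = q%:R - k%:R * n%:R :> Fc.
  by rewrite -natrM -qk -[in q%:R](prednK (ltnW residue_card_gt1)) -natr1 addrAC subrr add0r.
apply: maxOB; first exact: residue_card_maxO.
by apply: maxOMl => //; apply: OFc_nat.
Qed.

Variable i0 : 'I_q.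
Hypothesis r0 : maxO (iota (r i0)).

Lemma rep_not_maxO i : i != i0 -> ~ maxO (iota (r i)).
Proof.
by move=> ii0 hi; case/eqP: ii0; apply: rep_inj; apply: maxOB.
Qed.

(** Fermat's argument: multiplication by r(i) permutes the nonzero classes, so it fixes their
    product modulo the maximal ideal, and this product is a unit. *)
Lemma residue_fermat i : i != i0 -> maxO (iota (r i) ^+ q.-1 - 1).
Proof.
move=> /rep_not_maxO ri.
have rO j : O (iota (r j)) by apply: r_int.
have /choice[f hf] j : exists k, maxO (iota (r i * r j) - iota (r k)).
  by apply: rep_exists; rewrite rmorphM; apply: OFcM.
have f_inj : injective f.
  move=> j k fjk; apply: rep_inj.
  suff /maxO_prime[/ri[]|//] : maxO (iota (r i) * (iota (r j) - iota (r k))).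
  have -> : iota (r i) * (iota (r j) - iota (r k)) =
    iota (r i * r j) - iota (r (f j)) - (iota (r i * r k) - iota (r (f k))).
    by rewrite fjk !rmorphM; ring.
  exact: maxOB.
have f0 : f i0 = i0.
  apply: rep_inj; apply: maxOB => //.
  rewrite -[X in maxO X](subKr (iota (r i * r i0))).
  by apply: maxOB => //; rewrite rmorphM; apply: maxOMl.
have fP k : (k != i0) = (f k != i0) by rewrite -{2}f0 (inj_eq f_inj).
pose P := \prod_(k | k != i0) iota (r k).
have hP : maxO (iota (r i) ^+ q.-1 * P - P).
  have -> : iota (r i) ^+ q.-1 * P = \prod_(k | k != i0) iota (r i * r k).
    under [RHS]eq_bigr => k _ do rewrite rmorphM.
    rewrite big_split prodr_const /=; congr (_ ^+ _ * _).
    by rewrite (eq_card (B := predC1 i0)) ?cardC1 ?card_ord.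
  rewrite /P [X in _ - X](reindex_inj f_inj).
  rewrite [X in _ - X](eq_bigl (fun k => k != i0)) => [|k]; last by rewrite -fP.
  by apply: cong_prod => k _ //; rewrite rmorphM; apply: OFcM.
have : maxO ((iota (r i) ^+ q.-1 - 1) * P) by rewrite mulrBl mul1r.
case/maxO_prime=> // hP0; exfalso; move: hP0; rewrite /P -big_filter.
elim: [seq k <- _ | _] (filter_all (fun k => k != i0) (index_enum 'I_q))
  => [_|k t IH /= /andP[k0 kt]].
  by rewrite big_nil => /maxO1.
by rewrite big_cons => /maxO_prime[/(rep_not_maxO k0)|/IH]; auto.
Qed.

End Residues.

(** By counting, every (q-1)-st root of unity is congruent to an element of F. Hence [w x] and [x]
    are congruent roots of unity of order dividing q - 1, a unit of O, and so are equal. *)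
Lemma unity_fixed (z x : Fc) : (q.-1).-primitive_root z -> x ^+ q.-1 = 1 ->
  forall w : absgal, w x = x.
Proof.
move=> zP xq w; have [r r_int r_rep] := q_card.
have N0 : (0 < q.-1)%N := prim_order_gt0 zP.
have Nu := dvd_residue_card_not_maxO r_int r_rep (dvdnn q.-1).
have [|i0 r0] := rep_exists r_rep (x := 0); first by rewrite rmorph0; apply: OFc0.
move: r0; rewrite rmorph0 sub0r => /maxON; rewrite opprK => r0.
have zO i : O (z ^+ i) by apply/OFcX/(OFc_root N0); rewrite (prim_expr_order zP); apply: OFc1.
(* [None] is the target of the zero class. Both sides then have q elements, so injectivity of [t]
   yields that every root of unity is reached. *)
have tau i : exists j : option 'I_q.-1, if i == i0 then j = None else
    exists2 j', j = Some j' & maxO (iota (r i) - z ^+ j').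
  case: eqP => [|/eqP ii0]; first by exists None.
  have [j hj] := cong_unity_root zP (residue_fermat r_int r_rep r0 ii0).
  by exists (Some j); exists j.
have [t ht] := choice tau.
have t_inj : injective t.
  move=> i j tij; have := ht j; have := ht i; rewrite tij.
  case: eqP => [->|_]; case: eqP => [->|_] //; first by move=> ->  [].
    by move=> [? -> _].
  move=> [a -> ha] [b [<-] hb]; apply: (rep_inj r_int r_rep).
  rewrite -(subrKA (z ^+ a)) addrC.
  by rewrite -[_ - iota (r j)]opprB addrC; apply: maxOB.
have t_onto j : exists i, t i = j.
  have : j \in codom t.
    apply: inj_card_onto => //; rewrite card_option !card_ord prednK //.
    by rewrite (leq_trans N0) // leq_pred.
  by case/codomP=> i ->; exists i.
have xO : O x by apply: (OFc_root N0); rewrite xq; apply: OFc1.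
have [j hj] : exists j : 'I_q.-1, maxO (x - z ^+ j).
  by apply: (cong_unity_root zP); rewrite xq subrr; left.
have [i ti] := t_onto (Some j).
have [c hc] : exists c, maxO (x - iota c).
  exists (r i); have := ht i; rewrite ti; case: eqP => // _ [_ [<-] hz].
  by rewrite -(subrKA (z ^+ j)) addrC -[_ - iota (r i)]opprB addrC; apply: maxOB.
apply: (unity_cong N0 Nu) => //; first by rewrite -rmorphXn xq rmorph1.
have -> : w x - x = w (x - iota c) - (x - iota c) by rewrite rmorphB /= absgal_fix; ring.
by apply: maxOB => //; apply: absgal_maxO.
Qed.

End Uniformizer.

(** * Radical extensions *)

Definition absgal1 : absgal :=
  @AbsGal _ _ _ iota (idfun : {rmorphism Fc -> Fc}) (Bijective (fun=> erefl) (fun=> erefl))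
    (fun=> erefl).

(* This is F(z). *)
Definition stab_field (z : Fc) : set Fc :=
  [set y | forall w : absgal, w z = z -> w y = y].

Lemma stab_fieldV z y : stab_field z y -> stab_field z y^-1.
Proof. by move=> hy w wz; rewrite fmorphV hy. Qed.

Section Radical.
Hypothesis Fc_char0 : forall n, n.+1%:R != 0 :> Fc.
Variables (N : nat) (z : Fc) (A : F).
Hypotheses (N_gt0 : (0 < N)%N) (zN : z ^+ N = iota A) (z_neq0 : z != 0).

(* Kummer theory without roots of unity in F: averaging over the conjugates
   [c] of [z] gives the coefficients [N^-1 \sum_c y_c c^-k]. *)
Lemma stab_field_expand y : stab_field z y ->
  exists f : nat -> F, y = \sum_(k < N) iota (f k) * z ^+ k /\
    (~ maxO N%:R -> maxO y -> forall k, maxO (iota (f k) * z ^+ k)).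
Proof.
move=> hy; have N0 : (N%:R : Fc) != 0 by rewrite -(prednK N_gt0).
have [rs rsE] := closed_field_poly_normal ('X^N - (iota A)%:P).
have lX : lead_coef ('X^N - (iota A)%:P) = 1 by apply/eqP; rewrite -monicE monicXnsubC.
rewrite lX scale1r in rsE.
have rsP c : (c \in rs) = (c ^+ N == iota A).
  by rewrite -root_prod_XsubC -rsE /root !hornerE subr_eq0.
pose C := [seq c <- undup rs | `[< exists w : absgal, w z = c >] ].
have CP c : reflect (exists w : absgal, w z = c) (c \in C).
  rewrite mem_filter mem_undup; apply: (iffP andP) => [[/asboolP]//|[w wz]].
  split; first by apply/asboolP; exists w.
  by rewrite rsP -wz -rmorphXn zN /= absgal_fix.
have uC : uniq C by rewrite filter_uniq // undup_uniq.
(* [Y c] is the conjugate of [y] that belongs to the conjugate [c] of [z]; it is well defined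
   because [y] is fixed by the stabilizer of [z]. *)
have /choice[Y hY] c : exists Yc, forall w : absgal, w z = c -> w y = Yc.
  have [[w wz]|nw] := pselect (exists w : absgal, w z = c); last first.
    by exists 0 => w wz; case: nw; exists w.
  exists (w y) => w' wz'; have [v [wK vK]] := absgal_inv w.
  have := hy (absgal_mul v w'); rewrite /= wz' -wz wK => /(_ erefl) e.
  by rewrite -[LHS]vK e.
have C0 c : c \in C -> c != 0 by case/CP=> w <-; rewrite fmorph_eq0.
have CN c : c \in C -> (z / c) ^+ N = 1.
  case/CP=> w <-; rewrite exprMn exprVn -rmorphXn zN /= absgal_fix divff //.
  by rewrite -zN expf_neq0.
pose g k := N%:R^-1 * \sum_(c <- C) Y c * c ^- k.
have permC (w : absgal) : perm_eq (map w C) C.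
  have um : uniq (map w C) by rewrite map_inj_uniq //; apply: fmorph_inj.
  have sub : {subset map w C <= C}.
    by move=> _ /mapP[_ /CP[v <-] ->]; apply/CP; exists (absgal_mul w v).
  have [_ e] := uniq_min_size um sub (eq_leq (esym (size_map _ _))).
  exact: uniq_perm.
have gF k : exists c, g k = iota c.
  apply: absgal_fixed => // w; rewrite rmorphM fmorphV rmorph_nat rmorph_sum; congr (_ * _).
  rewrite -[RHS](perm_big _ (permC w)) big_map big_seq [RHS]big_seq; apply: eq_bigr => c.
  case/CP=> v vz; rewrite rmorphM fmorphV rmorphXn; congr (_ * _).
  by rewrite -(hY c v vz); apply: (hY _ (absgal_mul w v)); rewrite /= vz.
have [f hf] := choice gF.
have fz k : iota (f k) * z ^+ k = N%:R^-1 * \sum_(c <- C) Y c * (z / c) ^+ k.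
  rewrite -hf /g -mulrA mulr_suml; congr (_ * _); apply: eq_bigr => c _.
  by rewrite exprMn exprVn; ring.
exists f; split.
  under eq_bigr => k _ do rewrite fz.
  rewrite -mulr_sumr exchange_big /=.
  have zC : z \in C by apply/CP; exists absgal1.
  (* Summation over k removes every conjugate c <> z, as z / c is then an N-th root of unity other
     than 1. *)
  rewrite (bigD1_seq z) //= [X in _ + X]big1_seq => [|c /andP[cz cC]].
    under eq_bigr => k _ do rewrite divff // expr1n mulr1.
    rewrite sumr_const card_ord addr0 -[Y z *+ N]mulr_natr mulrCA mulVf // mulr1.
    by rewrite -(hY z absgal1 erefl).
  rewrite -mulr_sumr sum_expr_unity; last exact: CN.
  by rewrite divf_eq1 ?C0 // eq_sym (negbTE cz) mulr0.
move=> Nu My k; rewrite fz; apply: maxOMl; first by case: (maxOPn Nu).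
rewrite big_seq; apply: maxO_sum => c cC; apply: maxOMr.
  by case/CP: cC => w wz; rewrite -(hY c w wz); apply: absgal_maxO.
by apply/OFcX/(OFc_root N_gt0); rewrite CN //; apply: OFc1.
Qed.

Lemma stab_field_finite : finite_subext iota (stab_field z).
Proof.
split=> [x w _|x y hx hy w wz|x y hx hy w wz||].
- exact: absgal_fix.
- by rewrite rmorphB /= hx // hy.
- by rewrite rmorphM /= hx // hy.
- exact: stab_fieldV.
exists (mkseq (fun k => z ^+ k) N) => x /stab_field_expand[f [-> _]].
exists f; rewrite size_mkseq; apply: eq_bigr => i _.
by rewrite nth_mkseq.
Qed.

(** As N is a unit of O, the expansion of a nonunit of F(z) has all its terms in the maximal ideal,
    so divisibility by [x] can be tested on the monomials c z^k. *)
Lemma stab_field_uniformizer x : ~ maxO N%:R -> stab_field z x -> maxO x -> x != 0 ->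
  (forall c k, (k < N)%N -> maxO (iota c * z ^+ k) -> O (iota c * z ^+ k / x)) ->
  is_uniformizer absp iota (stab_field z) x.
Proof.
move=> Nu Lx Mx x0 hx; split=> //.
- by split=> //; apply: maxO_OFc.
- by case=> _ _ [_ hV]; case: Mx => // e; rewrite e eqxx in x0.
move=> y [Ly Oy] nU; split.
  by move=> w wz; rewrite fmorph_div /= Ly // Lx.
have My : maxO y.
  have [->|y0] := eqVneq y 0; first by left.
  by right=> hV; apply: nU; split=> //; split=> //; apply: stab_fieldV.
have [f [yE hf]] := stab_field_expand Ly.
have {}hf := hf Nu My; rewrite yE.
rewrite mulr_suml; apply: OFc_sum => k _; apply: hx; first exact: ltn_ord.
exact: hf.
Qed.

Lemma stab_field_self : stab_field z z.
Proof. by move=> w ->. Qed.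

End Radical.

(** * Unramified and tame elements *)

Section TameElements.
Hypothesis p_prime : prime p.
Hypothesis Fc_char0 : forall n, n.+1%:R != 0 :> Fc.
Variable pi : F.
Hypothesis pi_unif : is_uniformizer absp iota (range iota) (iota pi).
Local Notation Ft := (Ft absp iota p pi).
Local Notation Fnr := (Fnr absp iota pi).

Lemma Fnr_Ft x : Fnr x -> Ft x.
Proof.
by case=> L [hL ram Lx]; exists L; split=> //; exists 1%N; rewrite ?coprime1n.
Qed.

(** [pi] remains a uniformizer of F(z): since z is a unit, a monomial c z^k lies in the maximal
    ideal only if c does, and then pi divides c. *)
Lemma unity_Fnr N (z : Fc) : coprime N p -> N.-primitive_root z -> Fnr z.
Proof.
move=> Np zP; have N0 := prim_order_gt0 zP.
have zN : z ^+ N = iota 1 by rewrite rmorph1 (prim_expr_order zP).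
have z0 : z != 0.
  by apply: contra_eq_neq zN => ->; rewrite expr0n gtn_eqF // rmorph1 eq_sym oner_neq0.
have Nu : ~ maxO N%:R by apply: coprime_not_maxO Np.
exists (stab_field z); split; [exact: stab_field_finite N0 zN z0 | | exact: stab_field_self].
have p0 := pi_neq0 pi_unif.
exists (iota pi).
  apply: (stab_field_uniformizer _ N0 zN z0) => //; [|exact: pi_maxO|].
    by move=> w _; apply: absgal_fix.
  move=> c k _ hM; rewrite mulrAC; apply: OFcM; last first.
    by apply/OFcX/(OFc_root N0); rewrite zN rmorph1; apply: OFc1.
  apply: (pi_divides pi_unif).
  have -> : iota c = iota c * z ^+ k * z^-1 ^+ k.
    by rewrite -mulrA -exprMn divff // expr1n mulr1.
  apply: maxOMr => //; apply/OFcX/(OFc_root N0).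
  by rewrite exprVn zN rmorph1 invr1; apply: OFc1.
rewrite expr1 divff //; have h1 : stab_field z 1 by move=> w _; rewrite rmorph1.
by split; rewrite ?oner_eq0 ?invr1 //; split=> //; apply: OFc1.
Qed.

(** [x] is a uniformizer of F(x). If c lies in the maximal ideal, pi = x^n divides it. If c x^k does
    with 0 < k < n, then so does c pi, hence c is integral and x divides c x^k. *)
Lemma radical_Ft n x : coprime n p -> x ^+ n = iota pi -> Ft x.
Proof.
move=> np xn; have n0 : (0 < n)%N.
  by rewrite lt0n; apply: contraTneq np => ->; rewrite /coprime gcd0n gtn_eqF ?prime_gt1.
have p0 := pi_neq0 pi_unif.
have x0 : x != 0.
  by apply: contra_eq_neq xn => ->; rewrite expr0n gtn_eqF // eq_sym.
have Nu : ~ maxO n%:R by apply: coprime_not_maxO np.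
have xO : O x by apply: (OFc_root n0); rewrite xn; apply: (pi_OFc pi_unif).
have xM : maxO x by apply: (maxO_X (n := n)); rewrite xn; apply: pi_maxO.
exists (stab_field x); split; [exact: stab_field_finite n0 xn x0 | | exact: stab_field_self].
exists n => //; exists x; last first.
  rewrite xn divff //; have h1 : stab_field x 1 by move=> w _; rewrite rmorph1.
  by split; rewrite ?oner_eq0 ?invr1 //; split=> //; apply: OFc1.
apply: (stab_field_uniformizer _ n0 xn x0) => //.
move=> c [|k] kn hM.
  rewrite expr0 mulr1 in hM *.
  have -> : iota c / x = iota c / iota pi * x ^+ n.-1.
    have pe : iota pi = x * x ^+ n.-1 by rewrite -exprS prednK.
    by rewrite pe invfM mulrA divfK ?expf_neq0.
  by apply: OFcM; [apply: pi_divides | apply: OFcX].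
rewrite exprSr mulrA mulfK //; apply: OFcM; last exact: OFcX.
apply: (pi_divides_lt pi_unif).
have -> : iota c * iota pi = iota c * x ^+ k.+1 * x ^+ (n - k.+1).
  by rewrite -mulrA -exprD (subnKC (ltnW kn)) xn.
by apply: maxOMr => //; apply: OFcX.
Qed.

(** With x = 1 + t, the middle binomial coefficients of (1 + t)^p are divisible by p, so t^p lies in
    the maximal ideal. *)
Lemma frobenius_cong1 x : O x -> maxO (x ^+ p - 1) -> maxO (x - 1).
Proof.
move=> xO hx; apply: (maxO_X (n := p)).
have tO : O (x - 1) by apply: OFcB xO OFc1.
set t := x - 1 in tO *; have xt : x = 1 + t by rewrite /t; ring.
have p0 := prime_gt0 p_prime.
move: hx; rewrite xt exprDn big_ord_recr /= subnn expr0 mul1r binn mulr1n.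
rewrite (bigD1 (Ordinal p0)) //= subn0 expr1n expr0 mulr1 bin0 mulr1n.
set S := \sum_(_ < _ | _) _ => hS.
have -> : t ^+ p = (1 + S + t ^+ p - 1) - S by ring.
apply: maxOB => //; apply: maxO_sum => i i0.
have i1 : (0 < i)%N by rewrite lt0n; apply: contraNneq i0 => i0; apply/eqP/val_inj.
have /dvdnP[k ->] : (p %| 'C(p, i))%N by apply: prime_dvd_bin => //; rewrite i1 ltn_ord.
rewrite -mulr_natr natrM mulrA; apply: maxOMl; last exact: p_maxO.
by apply: OFcM; [apply: OFcM; apply: OFcX => //; apply: OFc1 | apply: OFc_nat].
Qed.

Variable q : nat.
Hypothesis q_card : is_residue_card absp iota pi q.
Variable zeta : nat -> Fc.
Hypothesis zeta_prim : forall n, (0 < n)%N -> n.-primitive_root (zeta n).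

(** Finiteness of the residue field of F(y): modulo the maximal ideal each power of [y] is a
    combination of y^j, j < d, with coefficients among q representatives, so two different powers
    are congruent. *)
Lemma power_cong1 y : O y -> ~ maxO y -> exists2 n, (0 < n)%N & maxO (y ^+ n - 1).
Proof.
move=> yO yM; have [r r_int r_rep] := q_card.
have [P mP rP] := (OFc_integral y).1 yO.
pose d := size P.
have redX k : exists g : 'I_q ^ d, maxO (y ^+ k - \sum_(j < d) iota (r (g j)) * y ^+ j).
  pose R := Pdiv.Ring.rmodp 'X^k P.
  have yk : y ^+ k = \sum_(j < d) (jQ \o (val : Zp_type QpP -> Qp)) R`_j * y ^+ j.
    have e := Pdiv.RingMonic.rdivp_eq mP 'X^k.
    have -> : y ^+ k = (map_poly (jQ \o (val : Zp_type QpP -> Qp)) 'X^k).[y].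
      by rewrite map_polyXn hornerXn.
    rewrite {1}e rmorphD rmorphM /= hornerD hornerM (rootP rP) mulr0 add0r.
    rewrite (@horner_coef_wide _ d).
      apply: eq_bigr => j _; congr (_ * _).
      exact: (coef_map (jQ \o (val : Zp_type QpP -> Qp))).
    apply: leq_trans (size_poly _ _) _; rewrite ltnW //.
    by apply: Pdiv.Ring.ltn_rmodpN0; apply: monic_neq0.
  have /choice[g hg] (j : 'I_d) : exists i,
      maxO ((jQ \o (val : Zp_type QpP -> Qp)) R`_j - iota (r i)).
    have := rep_exists pi_unif r_rep (x := in_alg F (val (R`_j : Zp_type QpP))).
    by apply; rewrite -[iota _]/(jQ _) OFc_Qp -(Zp_intE QpP); apply: valP.
  exists [ffun j => g j]; rewrite yk -sumrB; apply: maxO_sum => j _.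
  by rewrite ffunE -mulrBl; apply: maxOMr => //; apply: OFcX.
have [g hg] := choice redX.
pose T := {ffun 'I_d -> 'I_q}.
have /injectivePn[a [b ab gab]] : ~~ injectiveb (fun k : 'I_(#|{: T}|.+1) => (g k : T)).
  by apply/injectiveP => /leq_card; rewrite card_ord ltnn.
wlog lab : a b ab gab / (a < b)%N.
  move=> h; have [lab|lba|/val_inj e] := ltngtP a b; first exact: (h a b).
    by apply: (h b a) => //; rewrite eq_sym.
  by rewrite e eqxx in ab.
have hy : maxO (y ^+ b - y ^+ a).
  have := maxOB (hg b) (hg a); rewrite gab; congr (maxO _); ring.
exists (b - a)%N; first by rewrite subn_gt0.
have /maxO_prime[/maxO_X//|//] : maxO (y ^+ a * (y ^+ (b - a) - 1)).
by rewrite mulrBr mulr1 -exprD subnKC // ltnW.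
Qed.

(** Some power y^n is congruent to 1, and [frobenius_cong1] strips the p-part of n. *)
Lemma cong_tame_unity y : O y -> ~ maxO y ->
  exists N i, coprime N p /\ maxO (y - zeta N ^+ i).
Proof.
move=> yO /(power_cong1 yO)[n n0 hn]; pose N := (n`_p^')%N.
have N0 : (0 < N)%N by apply: part_gt0.
have Np : coprime N p.
  rewrite coprime_sym prime_coprime //.
  by have := part_pnat p^' n; rewrite p'natE.
have hN : maxO (y ^+ N - 1).
  have : maxO ((y ^+ N) ^+ (p ^ logn p n) - 1).
    by rewrite -exprM mulnC -p_part partnC.
  elim: (logn p n) => [|e IHe]; first by rewrite expn0 expr1.
  rewrite expnSr exprM => /frobenius_cong1 h; apply/IHe/h.
  by rewrite -exprM; apply: OFcX.
have [i hi] := cong_unity_root (zeta_prim N0) hN.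
by exists N, i.
Qed.

(** A unit [y] is congruent to a root of unity of order prime to p, on which [w] and [w'] agree
    because it is unramified. *)
Lemma unramified_cong (w w' : absgal) : (forall x, Fnr x -> w x = w' x) ->
  forall y, O y -> maxO (w y - w' y).
Proof.
move=> ww' y yO; have [yM|/(cong_tame_unity yO)[N [i [Np hy]]]] := pselect (maxO y).
  by apply: maxOB; apply: absgal_maxO.
have N0 : (0 < N)%N.
  by rewrite lt0n; apply: contraTneq Np => ->; rewrite /coprime gcd0n gtn_eqF ?prime_gt1.
have e : w (zeta N) = w' (zeta N).
  by apply/ww'/(unity_Fnr Np)/zeta_prim.
have -> : w y - w' y = w (y - zeta N ^+ i) - w' (y - zeta N ^+ i).
  by rewrite !rmorphB !rmorphXn /= e; ring.
by apply: maxOB; apply: absgal_maxO.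
Qed.

End TameElements.

(** * Galois action on the group algebra *)

Section Cosets.
Variable gT : finGroupType.
Local Notation FcG := (grpalg Fc gT).
Local Notation gact := (@gal_act Qp F Fc iota gT).

Lemma gactE (w : absgal) (x : FcG) t : gact w x t = w (x t).
Proof. exact: ffunE. Qed.

Lemma gactM (w : absgal) (x y : FcG) : gact w (x * y) = gact w x * gact w y.
Proof.
apply/ffunP=> t; rewrite gactE !grpalgM rmorph_sum; apply: eq_bigr => s _.
by rewrite rmorphM !gactE.
Qed.

Lemma gactZ (w : absgal) a (x : FcG) : gact w (a *: x) = w a *: gact w x.
Proof. by apply/ffunP=> t; rewrite gactE !grpalgZ rmorphM gactE. Qed.

Lemma gact_sum (w : absgal) I (r : seq I) (P : pred I) (E : I -> FcG) :
  gact w (\sum_(i <- r | P i) E i) = \sum_(i <- r | P i) gact w (E i).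
Proof.
apply/ffunP=> t; rewrite gactE !grpalg_sum rmorph_sum.
by apply: eq_bigr => i _; rewrite gactE.
Qed.

Lemma gact_gelt (w : absgal) g : gact w (gelt Fc g) = gelt Fc g.
Proof. by apply/ffunP=> t; rewrite gactE !ffunE rmorph_nat. Qed.

Lemma gact1 (w : absgal) : gact w 1 = 1.
Proof. exact: gact_gelt. Qed.

Definition OG (x : FcG) := forall t, O (x t).

Lemma OG_M x y : OG x -> OG y -> OG (x * y).
Proof.
by move=> hx hy t; rewrite grpalgM; apply: OFc_sum => s _; apply: OFcM.
Qed.

Lemma OG_sum I (r : seq I) (P : pred I) (E : I -> FcG) :
  (forall i, P i -> OG (E i)) -> OG (\sum_(i <- r | P i) E i).
Proof. by move=> h t; rewrite grpalg_sum; apply: OFc_sum => i Pi; apply: h. Qed.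

Lemma OG_Z a x : O a -> OG x -> OG (a *: x).
Proof. by move=> ha hx t; rewrite grpalgZ; apply: OFcM. Qed.

Lemma OG_gelt g : OG (gelt Fc g).
Proof. by move=> t; rewrite ffunE; apply: OFc_nat. Qed.

Definition MG (x : FcG) := forall t, maxO (x t).

Lemma MG_Ml x y : OG x -> MG y -> MG (x * y).
Proof.
by move=> hx hy t; rewrite grpalgM; apply: maxO_sum => s _; apply: maxOMl.
Qed.

Lemma MG_Mr x y : MG x -> OG y -> MG (x * y).
Proof.
by move=> hx hy t; rewrite grpalgM; apply: maxO_sum => s _; apply: maxOMr.
Qed.

Lemma gcoset_self (x : FcG) : gcoset x x.
Proof. by exists 1%g => //; rewrite gelt1 mulr1. Qed.

Lemma gcoset_gelt (x : FcG) g : gcoset (x * gelt Fc g) = gcoset x.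
Proof.
apply/seteqP; split=> [_ [h _ <-]|_ [h _ <-]].
  by exists (g * h)%g => //; rewrite -mulrA -geltM.
by exists (g^-1 * h)%g => //; rewrite -mulrA -geltM mulKVg.
Qed.

Lemma gact_gcoset (w : absgal) (x : FcG) : gact w @` gcoset x = gcoset (gact w x).
Proof.
apply/seteqP; split=> [_ [_ [g _ <-] <-]|_ [g _ <-]].
  by exists g => //; rewrite gactM gact_gelt.
by exists (x * gelt Fc g); [exists g | rewrite gactM gact_gelt].
Qed.

Lemma gcosetM_gcoset (x y : FcG) : abelian [set: gT]%SET ->
  gcosetM (gcoset x) (gcoset y) = gcoset (x * y).
Proof.
move=> Gab; apply/seteqP; split=> [_ [_ [g _ <-] [_ [h _ <-] <-]]|_ [g _ <-]].
  exists (g * h)%g => //; rewrite geltM -!mulrA; congr (_ * _).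
  by rewrite !mulrA (gmulC Gab y).
by exists x; [exact: gcoset_self | exists (y * gelt Fc g); [exists g | rewrite mulrA]].
Qed.

Lemma unit_gelt_inj (x v : FcG) g h : v * x = 1 ->
  x * gelt Fc g = x * gelt Fc h -> g = h.
Proof.
by move=> vx e; apply: (@gelt_inj Fc); rewrite -[LHS]mul1r -vx -mulrA e mulrA vx mul1r.
Qed.

(** The value of [assoc_hom] may come from another representative x k of the coset; commutativity of
    G cancels k. *)
Lemma assoc_homP (x v : FcG) (w : absgal) : v * x = 1 -> abelian [set: gT]%SET ->
  (exists g, gact w x = x * gelt Fc g) ->
  gact w x = x * gelt Fc (assoc_hom (gcoset x) w).
Proof.
move=> vx Gab [g hg].
have : exists g', [set g | exists2 x0, gcoset x x0 & gact w x0 = x0 * gelt Fc g] g'.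
  by exists g, x => //; apply: gcoset_self.
move/(xgetPex 1%g); rewrite -/(assoc_hom (gcoset x) w).
set g' := assoc_hom _ _; case=> _ [k _ <-]; rewrite gactM gact_gelt => e.
have : gact w x * gelt Fc k * gelt Fc k^-1%g = x * gelt Fc k * gelt Fc g' * gelt Fc k^-1%g.
  by rewrite e.
rewrite -!mulrA -!geltM mulgV gelt1 mulr1 => ->; congr (_ * gelt Fc _).
rewrite (centsP Gab k _ (g' * k^-1)%g) ?inE //.
by rewrite mulgKV.
Qed.

Lemma resolventE (a : {ffun gT -> Fc}) t : resolvend a t = a t^-1%g.
Proof.
rewrite /resolvend grpalg_sum (bigD1 t^-1%g) //= big1 => [|s st].
  by rewrite grpalgZ ffunE invgK eqxx mulr1 addr0.
rewrite grpalgZ ffunE; case: eqP => [e|_]; last by rewrite mulr0.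
by rewrite e invgK eqxx in st.
Qed.

End Cosets.

(** * The Stickelberger element *)

Section Stickelberger.
Variables (gT : finGroupType) (pi : F) (q : nat) (zeta rad : nat -> Fc) (s : gT).
Hypotheses (p_prime : prime p) (G_abelian : abelian [set: gT]%SET) (G_odd : odd #|gT|).
Hypothesis pi_unif : is_uniformizer absp iota (range iota) (iota pi).
Hypothesis q_card : is_residue_card absp iota pi q.
Hypothesis zeta_prim : forall n, (0 < n)%N -> n.-primitive_root (zeta n).
Hypothesis zeta_compat : forall m n, (0 < m)%N -> (0 < n)%N ->
     zeta (m * n)%N ^+ m = zeta n.
Hypothesis rad_root : forall n, coprime n p -> rad n ^+ n = iota pi.
Hypothesis s_ord : (#[s]%g %| q.-1)%N.

Local Notation FcG := (grpalg Fc gT).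
Local Notation gact := (@gal_act Qp F Fc iota gT).
Local Notation n := #[s]%g.
Local Notation m := (#[s]%g)./2.
Local Notation z := (zeta #[s]%g).
Local Notation rn := (rad #[s]%g).
Local Notation Ft := (Ft absp iota p pi).
Local Notation Fnr := (Fnr absp iota pi).

Lemma Fc_char0 k : k.+1%:R != 0 :> Fc.
Proof. exact: prim_root_natf_neq0 (zeta_prim (ltn0Sn k)). Qed.

Let n_gt0 : (0 < n)%N := order_gt0 s.
Let zP : n.-primitive_root z := zeta_prim n_gt0.
Let sn : (s ^+ n = 1)%g := expg_order s.

Lemma order_double : n = (m + m).+1.
Proof.
have on : odd n.
  have sG : s \in [set: gT]%G by rewrite inE.
  have := order_dvdG sG; rewrite cardsT => h.
  exact: dvdn_odd h G_odd.
by rewrite addnn -[LHS]odd_double_half on.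
Qed.

Lemma order_not_maxO : ~ maxO n%:R.
Proof.
have [r r_int r_rep] := q_card.
exact: (dvd_residue_card_not_maxO pi_unif r_int r_rep).
Qed.

Lemma order_coprime : coprime n p.
Proof.
rewrite coprime_sym prime_coprime //; apply/negP => /dvdnP[k nk].
apply: order_not_maxO; rewrite nk natrM; apply: maxOMl; [exact: OFc_nat | exact: p_maxO].
Qed.

Let rn_n : rn ^+ n = iota pi := rad_root order_coprime.

Lemma rad_neq0 : rn != 0.
Proof.
have := pi_neq0 pi_unif; rewrite -rn_n; apply: contraNneq => ->.
by rewrite expr0n gtn_eqF.
Qed.

Lemma rad_OFc : O rn.
Proof. by apply: (OFc_root n_gt0); rewrite rn_n; apply: (pi_OFc pi_unif). Qed.

Lemma zeta_neq0 : z != 0.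
Proof.
by have := oner_neq0 Fc; rewrite -(prim_expr_order zP); apply: contraNneq => ->;
  rewrite expr0n gtn_eqF.
Qed.

Lemma zetaV_OFc i : O (z^-1 ^+ i).
Proof.
by apply/OFcX/(OFc_root n_gt0); rewrite exprVn (prim_expr_order zP) invr1; apply: OFc1.
Qed.

Lemma zeta_fixed (w : absgal) : w z = z.
Proof.
have [r r_int r_rep] := q_card.
have q1 : (0 < q.-1)%N.
  by rewrite -subn1 subn_gt0 (residue_card_gt1 pi_unif r_rep).
apply: (unity_fixed pi_unif q_card (zeta_prim q1)).
by case/dvdnP: s_ord => k ->; rewrite mulnC exprM (prim_expr_order zP) expr1n.
Qed.

Local Notation e := (gidem n z s).

(* The element of F^cG on which [chi] takes the value [phi k] when
   [chi s = z ^+ k]. *)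
Definition gtheta (phi : nat -> Fc) : FcG := \sum_(k < n) phi k *: e k.

Lemma gthetaM phi psi : gtheta phi * gtheta psi = gtheta (fun k => phi k * psi k).
Proof.
rewrite /gtheta mulr_suml; apply: eq_bigr => k _; rewrite mulr_sumr (bigD1 k) //= big1.
  by rewrite addr0 -gscaleAr -gscaleAl gidemM // eqxx scalerA mulrC.
move=> l lk; rewrite -gscaleAr -gscaleAl gidemM // eq_sym (negbTE lk).
by rewrite !scaler0.
Qed.

Lemma gtheta1 phi : (forall k, phi k = 1) -> gtheta phi = 1.
Proof.
move=> h; rewrite /gtheta; under eq_bigr => k _ do rewrite h scale1r.
exact: gidem_sum.
Qed.

Lemma gthetaV phi : (forall k, phi k != 0) ->
  gtheta phi * gtheta (fun k => (phi k)^-1) = 1.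
Proof. by move=> h; rewrite gthetaM; apply: gtheta1 => k; rewrite divff. Qed.

Lemma gidem_OG k : OG (e k).
Proof.
apply: OG_Z; first by case: (maxOPn order_not_maxO).
by apply: OG_sum => i _; apply: OG_Z; [apply: zetaV_OFc | apply: OG_gelt].
Qed.

Lemma gtheta_OG c phi : (forall k, (k < n)%N -> O (c * phi k)) -> OG (c *: gtheta phi).
Proof.
move=> h; rewrite /gtheta scaler_sumr; apply: OG_sum => k _.
by rewrite scalerA; apply: OG_Z; [apply: h | apply: gidem_OG].
Qed.

(** The coefficient of the idempotent at 1 is 1/n, whose inverse is integral. *)
Lemma gidem_not_MG k : ~ MG (e k).
Proof.
move=> /(_ 1%g); rewrite grpalgZ grpalg_sum (bigD1 (Ordinal n_gt0)) //= big1 => [|i i0].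
  rewrite grpalgZ muln0 expr0 mul1r addr0 expg0 ffunE eqxx mulr1.
  by have [n0 _] := maxOPn order_not_maxO; case=> [/eqP|]; [rewrite invr_eq0 (negbTE n0)
    | rewrite invrK => /(_ (OFc_nat _))].
rewrite grpalgZ ffunE; case: eqP => [h|_]; last by rewrite mulr0.
case/eqP: i0; apply/val_inj => /=; apply/eqP.
have := eq_expg_mod_order s 0 i; rewrite expg0 h eqxx mod0n modn_small //.
by rewrite eq_sym => <-.
Qed.

Lemma gact_gidem (w : absgal) k : gact w (e k) = e k.
Proof.
rewrite gactZ gact_sum fmorphV rmorph_nat; congr (_ *: _); apply: eq_bigr => i _.
by rewrite gactZ gact_gelt rmorphXn fmorphV /= zeta_fixed.
Qed.

Lemma gact_gtheta (w : absgal) phi i : (forall k, w (phi k) = z ^+ (k * i) * phi k) ->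
  gact w (gtheta phi) = gtheta phi * gelt Fc (s ^+ i)%g.
Proof.
move=> h; rewrite gact_sum mulr_suml; apply: eq_bigr => k _.
by rewrite gactZ gact_gidem -gscaleAl (gidem_geltX zP sn) [RHS]scalerA h [z ^+ _ * _]mulrC.
Qed.

Lemma geval_gtheta (chi : dual gT Fc) phi (k : 'I_n) : chi s = z ^+ k ->
  geval chi (gtheta phi) = phi k.
Proof.
move=> hk; rewrite geval_sum (bigD1 k) //= big1 ?addr0 => [|l lk].
  by rewrite gevalZ geval_gidem ?dualP // hk eqxx mulr1.
rewrite gevalZ geval_gidem ?dualP // hk (eq_prim_root_expr zP) !modn_small //.
by rewrite eq_sym (inj_eq val_inj) (negbTE lk) mulr0.
Qed.

Lemma absgal_rad (w : absgal) : exists i : 'I_n, w rn = z ^+ i * rn.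
Proof.
have h : (w rn / rn) ^+ n = 1.
  by rewrite exprMn exprVn -rmorphXn rn_n /= absgal_fix divff // pi_neq0.
by have [i hi] := prim_rootP zP h; exists i; rewrite -hi divfK // rad_neq0.
Qed.

(* If [chi s = z ^+ k] then [<chi, s>_* = sym_rep k / n]. *)
Definition sym_rep (k : nat) : int := if (k <= m)%N then k%:Z else k%:Z - n%:Z.

Definition phi_sym k := rn ^ sym_rep k.
Definition phi_int k := rn ^+ k.

Lemma phi_sym_neq0 k : phi_sym k != 0.
Proof. by rewrite expfz_neq0 // rad_neq0. Qed.

Lemma phi_int_neq0 k : phi_int k != 0.
Proof. by rewrite expf_neq0 // rad_neq0. Qed.

Lemma absgal_phi_int (w : absgal) i k : w rn = z ^+ i * rn ->
  w (phi_int k) = z ^+ (k * i) * phi_int k.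
Proof. by move=> h; rewrite rmorphXn /= h exprMn -exprM mulnC. Qed.

Lemma zetaXn k : z ^ (k%:Z - n%:Z) = z ^+ k.
Proof. by rewrite expfzDr ?zeta_neq0 // -exprnN -exprnP (prim_expr_order zP) invr1 mulr1. Qed.

Lemma zeta_sym_rep k : z ^ sym_rep k = z ^+ k.
Proof. by rewrite /sym_rep; case: ifP => // _; apply: zetaXn. Qed.

Lemma absgal_phi_sym (w : absgal) i k : w rn = z ^+ i * rn ->
  w (phi_sym k) = z ^+ (k * i) * phi_sym k.
Proof.
move=> h; rewrite fmorphXz /= h expfzMl; congr (_ * _).
by rewrite exprnP exprz_exp mulrC -exprz_exp zeta_sym_rep -exprnP -exprM.
Qed.

Lemma phi_sym_OFc k : (k < n)%N -> O (rn ^+ m * phi_sym k) /\ O (rn ^+ m * (phi_sym k)^-1).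
Proof.
move=> kn; have nE := order_double; have rn0 := rad_neq0.
have pos (j : int) : 0 <= m%:Z + j -> O (rn ^+ m * rn ^ j).
  by rewrite exprnP -expfzDr //; case: (_ + j) => // l _; apply/OFcX/rad_OFc.
rewrite /phi_sym invr_expz; split; apply: pos; rewrite /sym_rep; case: ifP => h; lia.
Qed.

(* [theta0] represents [Theta (f_s)]; [theta1] has the same associated
   homomorphism but integral coefficients, and serves to test the elements of the
   inverse different. *)
Definition theta0 := gtheta phi_sym.
Definition theta0V := gtheta (fun k => (phi_sym k)^-1).
Definition theta1 := gtheta phi_int.
Definition theta1V := gtheta (fun k => (phi_int k)^-1).

Lemma theta0_OG : OG (rn ^+ m *: theta0).
Proof. by apply: gtheta_OG => k /phi_sym_OFc[]. Qed.

Lemma theta0V_OG : OG (rn ^+ m *: theta0V).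
Proof. by apply: gtheta_OG => k /phi_sym_OFc[]. Qed.

Lemma theta1_OG : OG theta1.
Proof.
rewrite -[theta1]scale1r; apply: gtheta_OG => k _.
by rewrite mul1r; apply/OFcX/rad_OFc.
Qed.

Lemma theta1V_OG : OG (rn ^+ (m + m) *: theta1V).
Proof.
apply: gtheta_OG => k kn; have km : (k <= m + m)%N by rewrite -ltnS -order_double.
rewrite -{1}(subnK km) exprD mulfK ?phi_int_neq0 //.
by apply/OFcX/rad_OFc.
Qed.

(** The denominator r^m of theta is attained, namely by the term with exponent -m; multiplication by
    its idempotent isolates it. *)
Lemma theta0_not_MG : ~ MG (rn ^+ m *: theta0).
Proof.
(* The exponent -m = (m + 1) - n belongs to the index m + 1. Reduction modulo n matters only for n =
   1, where m = 0 and the index is 0. *)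
move=> h; pose j := (m.+1 %% n)%N; have jn : (j < n)%N by rewrite ltn_mod.
have phij : phi_sym j = rn ^- m.
  rewrite /phi_sym exprnN; congr (_ ^ _); rewrite /sym_rep /j.
  have nE := order_double; case m0 : m nE => [|m'] nE.
    by rewrite nE modn1.
  by rewrite modn_small; [rewrite ltnn; lia | lia].
apply: (gidem_not_MG (k := j)).
rewrite (_ : e j = rn ^+ m *: theta0 * e j); first exact: MG_Mr h (gidem_OG j).
rewrite -gscaleAl mulr_suml (bigD1 (Ordinal jn)) //= big1 => [|l lj].
  rewrite addr0 -gscaleAl (gidemM zP sn (Ordinal jn) (Ordinal jn)) eqxx scalerA phij.
  by rewrite divff ?scale1r // expf_neq0 // rad_neq0.
by rewrite -gscaleAl (gidemM zP sn l (Ordinal jn)) (negbTE lj) scaler0.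
Qed.


Lemma zdual_prodM (f g : dual gT Fc -> Fc) (psi : {freeg (dual gT Fc) / int}) :
  zdual_prod (fun chi => f chi * g chi) psi = zdual_prod f psi * zdual_prod g psi.
Proof.
by rewrite /zdual_prod -big_split; apply: eq_bigr => chi _; rewrite expfzMl.
Qed.

Lemma zetaX_eq1 (j : int) : z ^ j = 1 -> (n %| `|j|)%N.
Proof.
case: j => l h; first by rewrite absz_nat (prim_order_dvd zP); apply/eqP.
rewrite NegzE in h *; rewrite abszN absz_nat (prim_order_dvd zP); apply/eqP.
by move: h; rewrite -exprnN => h; rewrite -[LHS]invrK h invr1.
Qed.

Lemma char_zetaX (chi : dual gT Fc) : exists k : 'I_n, chi s = z ^+ k.
Proof.
have /andP[/eqP c1 /forallP cM] := dualP chi.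
have cX i : chi (s ^+ i)%g = chi s ^+ i.
  by elim: i => [|i IHi]; rewrite ?c1 // expgS exprS -IHi; apply/eqP/(forallP (cM s)).
have hx : chi s ^+ n = 1 by rewrite -cX sn.
by have [k hk] := prim_rootP zP hx; exists k.
Qed.

(** Two integers giving the same power of [z] differ by a multiple of n, whereas the admissible
    interval has length n - 1. *)
Lemma stick_numE (chi : dual gT Fc) (k : 'I_n) : chi s = z ^+ k ->
  stick_num zeta chi s = sym_rep k.
Proof.
move=> hk; have nE := order_double; have kn := ltn_ord k.
have bd : 1 - n%:Z <= sym_rep k *+ 2 <= n%:Z - 1.
  by rewrite /sym_rep; case: ifP => h; rewrite mulr2n; apply/andP; split; lia.
have [b1 b2] := andP bd.
apply: xget_unique => [|v [v1 v2 hv]]; first by split; rewrite ?zeta_sym_rep.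
have : (n %| `|(v - sym_rep k)%R|)%N.
  apply: zetaX_eq1; rewrite expfzDr ?zeta_neq0 // -invr_expz zeta_sym_rep -hv hk divff //.
  by rewrite expf_neq0 // zeta_neq0.
case: (eqVneq v (sym_rep k)) => // nv /dvdn_leq; rewrite absz_gt0 subr_eq0 nv => /(_ isT).
move: b1 b2 v1 v2; rewrite !mulr2n; lia.
Qed.

Lemma geval_theta0 (chi : dual gT Fc) : geval chi theta0 = rn ^ stick_num zeta chi s.
Proof. by have [k hk] := char_zetaX chi; rewrite (geval_gtheta _ hk) (stick_numE hk). Qed.

Lemma zdual_prodX (x : Fc) (v : dual gT Fc -> int) psi : x != 0 ->
  zdual_prod (fun chi => x ^ v chi) psi = x ^ (\sum_(chi <- dom psi) v chi * coeff chi psi).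
Proof.
move=> x0; rewrite /zdual_prod; elim: (dom psi) => [|c r IHr]; first by rewrite !big_nil.
by rewrite !big_cons IHr exprz_exp expfzDr.
Qed.

(** The value of theta at psi is r^S with S the sum of the upsilon's. Since psi is in [A_dual], z^S
    = psi(s) = 1, so n divides S and r^S = pi^(S/n). *)
Lemma rag_theta0 psi : A_dual psi ->
  rag theta0 psi = Theta_hom zeta (f_ iota pi s) psi.
Proof.
move=> psiA; rewrite -[rag _ _]/(zdual_prod (fun chi : dual gT Fc => geval chi theta0) psi).
set S := \sum_(chi <- dom psi) stick_num zeta chi s * coeff chi psi.
have -> : zdual_prod (fun chi : dual gT Fc => geval chi theta0) psi = rn ^ S.
  rewrite -zdual_prodX ?rad_neq0 //; apply: eq_bigr => chi _.
  by rewrite geval_theta0.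
have zS : z ^ S = 1.
  rewrite -zdual_prodX ?zeta_neq0 // -[RHS](psiA s); apply: eq_bigr => chi _.
  by have [k hk] := char_zetaX chi; rewrite (stick_numE hk) zeta_sym_rep hk.
have [N SN] : exists N, S = N * n%:Z.
  by apply/dvdzP; rewrite dvdzE absz_nat; apply: zetaX_eq1.
have stN : stick zeta psi s = N%:~R.
  have n0 : (n%:R : rat) != 0 by rewrite pnatr_eq0 -lt0n.
  have SNr : N%:~R * n%:R = S%:~R :> rat by rewrite SN intrM.
  apply: (mulIf n0); rewrite SNr /S rmorph_sum mulr_suml.
  by apply: eq_bigr => chi _; rewrite mulrA divfK // mulrC -intrM.
rewrite SN mulrC -exprz_exp -exprnP rn_n /Theta_hom.
have [s1|s1] := eqVneq s 1%g; last first.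
  rewrite (bigD1 s) //= big1 => [|t ts]; last by rewrite /f_ (negbTE ts) exp1rz.
  by rewrite /f_ eqxx s1 mulr1 stN intrKfloor.
rewrite big1 => [|t _]; last by rewrite /f_ s1 eqxx andbF exp1rz.
(* For s = 1 the function f_s is identically 1 by definition, and theta agrees because all exponents
   are 0. *)
suff -> : N = 0 by rewrite expr0z.
have : S = 0.
  rewrite /S big1 // => chi _; have [k hk] := char_zetaX chi; rewrite (stick_numE hk).
  have k0 : nat_of_ord k = 0%N by have := ltn_ord k; rewrite {2}s1 order1; case: (nat_of_ord k).
  by rewrite k0 mul0r.
by rewrite SN s1 order1 mulr1.
Qed.

Lemma theta0_unit : theta0 * theta0V = 1.
Proof. by apply: gthetaV => k; apply: phi_sym_neq0. Qed.

Lemma theta1_unit : theta1 * theta1V = 1.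
Proof. by apply: gthetaV => k; apply: phi_int_neq0. Qed.

Lemma gact_theta0 (w : absgal) i : w rn = z ^+ i * rn ->
  gact w theta0 = theta0 * gelt Fc (s ^+ i)%g.
Proof. by move=> h; apply: gact_gtheta => k; apply: absgal_phi_sym. Qed.

Lemma gact_theta1 (w : absgal) i : w rn = z ^+ i * rn ->
  gact w theta1 = theta1 * gelt Fc (s ^+ i)%g.
Proof. by move=> h; apply: gact_gtheta => k; apply: absgal_phi_int. Qed.

(** Since [w] fixes z, k = 1 modulo n and s^k = s. As k is prime to the exponent of G, t^k = s holds
    only for t = s, so f_s takes the same value at t and t^k. *)
Lemma Lambda_f : Lambda iota zeta (f_ iota pi s).
Proof.
split=> [t|w k /= hk t].
  by rewrite /f_; case: ifP => _; rewrite ?oner_neq0 // pi_neq0.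
set e0 := exponent [set: gT]%SET in hk *.
have sG : s \in [set: gT]%G by rewrite inE.
have e_gt0 : (0 < e0)%N := exponent_gt0 [set: gT]%G.
have ne : (n %| e0)%N := dvdn_exponent sG.
have zeE : zeta e0 ^+ (e0 %/ n) = z.
  by rewrite -{1}(divnK ne) zeta_compat // divn_gt0 // dvdn_leq.
have zk : z ^+ k = z.
  by rewrite -{1}zeE exprAC -hk -rmorphXn zeE /= zeta_fixed.
have sk : (s ^+ k = s)%g.
  apply/eqP; rewrite -{2}(expg1 s) eq_expg_mod_order.
  by rewrite -(eq_prim_root_expr zP) zk expr1.
have cke : coprime k e0.
  have := zeta_prim e_gt0; rewrite -(fmorph_primitive_root w) hk.
  by rewrite prim_root_exp_coprime // zeta_prim.
have -> : f_ iota pi s t = f_ iota pi s (t ^+ k)%g.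
  suff tE : (t == s) = (t ^+ k == s)%g by rewrite /f_ tE.
  apply/eqP/eqP=> [->//|tk].
  have tG : (t * s^-1)%g \in [set: gT]%G by rewrite inE.
  have : (#[(t * s^-1)%g]%g %| gcdn k e0)%N.
    rewrite dvdn_gcd (dvdn_exponent tG) andbT order_dvdn expgMn; last first.
      by apply: (centsP G_abelian); rewrite inE.
    by rewrite expgVn tk sk mulgV.
  rewrite (eqP cke) dvdn1 order_eq1 => /eqP h.
  by rewrite -[t](mulgKV s) h mul1g.
by rewrite /f_; case: ifP => _; rewrite ?rmorph1 ?absgal_fix.
Qed.

Lemma HFG_theta0 : HFG iota (gcoset theta0).
Proof.
split=> [|w].
  exists theta0 => //; split=> //; exists theta0V; split=> //; first exact: theta0_unit.
  by rewrite (gmulC G_abelian) theta0_unit.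
have [i hi] := absgal_rad w.
by rewrite gact_gcoset (gact_theta0 hi) gcoset_gelt.
Qed.

Lemma geval1 (chi : dual gT Fc) : geval chi 1 = 1.
Proof. by rewrite -gelt1 geval_gelt; have /andP[/eqP] := dualP chi. Qed.

Lemma geval_unit (chi : dual gT Fc) x y : x * y = 1 -> geval chi x != 0.
Proof.
move=> xy; have := geval1 chi; rewrite -xy gevalM ?dualP // => h.
by apply/eqP => x0; move/eqP: h; rewrite x0 mul0r eq_sym oner_eq0.
Qed.

(** Any other candidate x' has the same values as theta on [A_dual], so x' theta^-1 is trivial there
    and [rag_trivial_gelt] makes it a group element. *)
Lemma ThetaE : Theta iota zeta (f_ iota pi s) = gcoset theta0.
Proof.
apply: xget_unique => [|X' [_ [[x' [_ [v [_ xv _]]] ->] _] hX']].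
  split; [exact: Lambda_f | exact: HFG_theta0 | move=> _ [g _ <-] psi psiA].
  rewrite -(rag_theta0 psiA).
  rewrite -[LHS]/(zdual_prod (fun chi : dual gT Fc => geval chi (theta0 * gelt Fc g)) psi).
  rewrite -[RHS]mulr1 -(psiA g) -[RHS]zdual_prodM; apply: eq_bigr => chi _.
  by rewrite gevalM ?dualP // geval_gelt.
have [||||g hg] := rag_trivial_gelt (N := #|gT|) (z := zeta #|gT|) (x := x' * theta0V) G_abelian.
- by apply: zeta_prim; rewrite -cardsT cardG_gt0.
- by [].
- move=> chi; rewrite gevalM ?dualP // mulf_neq0 ?(geval_unit _ xv) //.
  by apply: (geval_unit _ (y := theta0)); rewrite (gmulC G_abelian) theta0_unit.
- move=> psi psiA; have h1 := hX' _ (gcoset_self x') _ psiA.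
  have h0 := rag_theta0 psiA.
  have hz : zdual_prod (fun chi : dual gT Fc =>
      geval chi theta0 * geval chi (x' * theta0V)) psi = rag x' psi.
    apply: eq_bigr => chi _; rewrite -gevalM ?dualP //.
    by rewrite [x' * _](gmulC G_abelian) mulrA theta0_unit mul1r.
  have t0 : rag theta0 psi != 0.
    by rewrite h0; apply/prodf_neq0 => t _; rewrite expfz_neq0 //; have [] := Lambda_f.
  apply: (mulfI t0); rewrite mulr1 -[LHS]zdual_prodM.
  by rewrite hz h1.
by rewrite -[x']mulr1 -theta0_unit (gmulC G_abelian theta0) mulrA hg (gmulC G_abelian) gcoset_gelt.
Qed.


Lemma pi_rad : iota pi = rn ^+ (m + m) * rn.
Proof. by rewrite -exprSr -order_double rn_n. Qed.

Lemma rad_maxO : maxO rn.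
Proof. by apply: (maxO_X (n := n)); rewrite rn_n; apply: pi_maxO. Qed.

(** * The generator of A_h *)

Section Generator.
Variables (u0 u0V : FcG).
Hypotheses (u0_OG : OG u0) (u0V_OG : OG u0V) (u0_unit : u0 * u0V = 1).
Hypothesis u0_stable : forall w : absgal, exists g, gact w u0 = u0 * gelt Fc g.

Let x0 : FcG := u0 * theta0.
Let x0V : FcG := theta0V * u0V.
Let h : absgal -> gT := assoc_hom (gcoset x0).
Let L : set Fc := fixfield h.

Local Notation gmulC := (gmulC G_abelian).

Lemma x0_unit : x0 * x0V = 1.
Proof. by rewrite /x0 /x0V mulrA -[u0 * _ * _]mulrA theta0_unit mulr1. Qed.

Lemma x0V_unit : x0V * x0 = 1.
Proof. by rewrite gmulC x0_unit. Qed.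

Lemma gact_product (w : absgal) g i : gact w u0 = u0 * gelt Fc g ->
  w rn = z ^+ i * rn -> gact w x0 = x0 * gelt Fc (g * s ^+ i)%g.
Proof.
move=> hg hi; rewrite gactM hg (gact_theta0 hi) geltM /x0 -!mulrA; congr (_ * _).
by rewrite !mulrA [gelt Fc g * _]gmulC.
Qed.

Lemma gact_assoc_hom (w : absgal) : gact w x0 = x0 * gelt Fc (h w).
Proof.
apply: (assoc_homP x0V_unit G_abelian).
have [g hg] := u0_stable w; have [i hi] := absgal_rad w.
by exists (g * s ^+ i)%g; apply: gact_product.
Qed.

Lemma assoc_hom_eq (w : absgal) g : gact w x0 = x0 * gelt Fc g -> h w = g.
Proof. by rewrite gact_assoc_hom; apply: unit_gelt_inj x0V_unit. Qed.

Lemma assoc_homM (w w' : absgal) : h (absgal_mul w w') = (h w * h w')%g.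
Proof.
apply: assoc_hom_eq; apply: (etrans (y := gact w (gact w' x0))).
  by apply/ffunP=> t; rewrite !gactE.
by rewrite (gact_assoc_hom w') gactM gact_gelt (gact_assoc_hom w) -mulrA -geltM.
Qed.

Lemma assoc_hom_cont : is_cont_hom h.
Proof.
split; first exact: assoc_homM.
exists [seq x0 t | t : gT] => w hw; apply: assoc_hom_eq.
rewrite gelt1 mulr1; apply/ffunP=> t; rewrite gactE; apply: hw.
by apply/mapP; exists t; rewrite ?mem_enum.
Qed.

(** g - g' = u0^-1 (w u0 - w' u0) has its coefficients in the maximal ideal, but one of them is 1 if
    g <> g'. *)
Lemma u0_stable_cong (w w' : absgal) g g' : (forall x, Fnr x -> w x = w' x) ->
  gact w u0 = u0 * gelt Fc g -> gact w' u0 = u0 * gelt Fc g' -> g = g'.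
Proof.
move=> ww' hg hg'.
have hM0 : MG (gelt Fc g - gelt Fc g').
  rewrite -[_ - _]mul1r -u0_unit [u0 * u0V]gmulC -mulrA mulrBr -hg -hg'.
  apply: MG_Ml => // t; rewrite grpalgB !gactE.
  exact: (unramified_cong p_prime Fc_char0 pi_unif q_card zeta_prim ww').
apply/eqP; apply: contraT => gg'; exfalso; apply: maxO1.
by have := hM0 g; rewrite grpalgB !ffunE eqxx (negbTE gg') subr0.
Qed.

Lemma rad_Ft : Ft rn.
Proof. exact: (radical_Ft p_prime Fc_char0 pi_unif order_coprime rn_n). Qed.

Lemma assoc_hom_tame (w w' : absgal) : (forall x, Ft x -> w x = w' x) -> h w = h w'.
Proof.
move=> ww'; have [g hg] := u0_stable w; have [g' hg'] := u0_stable w'.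
have [i hi] := absgal_rad w; have hi' : w' rn = z ^+ i * rn by rewrite -ww' //; apply: rad_Ft.
have gg' : g = g'.
  by apply: (u0_stable_cong _ hg hg') => x /Fnr_Ft; apply: ww'.
by rewrite (assoc_hom_eq (gact_product hg hi)) (assoc_hom_eq (gact_product hg' hi')) gg'.
Qed.

Lemma assoc_hom_sigma (w : absgal) : (forall x, Fnr x -> w x = x) -> w rn = z * rn -> h w = s.
Proof.
move=> wnr wr; have [g hg] := u0_stable w.
have g1 : g = 1%g.
  by apply: (u0_stable_cong (w' := absgal1) wnr hg);
    rewrite gelt1 mulr1; apply/ffunP=> t; rewrite gactE.
by rewrite (assoc_hom_eq (gact_product hg (i := 1%N) wr)) g1 mul1g expg1.
Qed.

Definition gen_of (x : FcG) : {ffun gT -> Fc} := [ffun t => x t^-1%g].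

Lemma gen_ofE x t : gen_of x t = x t^-1%g.
Proof. exact: ffunE. Qed.

Lemma resolvend_gen_of x : resolvend (gen_of x) = x.
Proof. by apply/ffunP=> t; rewrite resolventE gen_ofE invgK. Qed.

Lemma gen_of_equiv (x : FcG) (w : absgal) t : gact w x = x * gelt Fc (h w) ->
  w (gen_of x t) = gen_of x (h w * t)%g.
Proof.
by move=> hx; rewrite !gen_ofE -(gactE w) hx mulr_gelt invMg.
Qed.

Let a := gen_of x0.
Let x1 : FcG := u0 * theta1.
Let x1V : FcG := theta1V * u0V.
Let a1 := gen_of x1.

Lemma gact_x1 (w : absgal) : gact w x1 = x1 * gelt Fc (h w).
Proof.
have [g hg] := u0_stable w; have [i hi] := absgal_rad w.
rewrite (assoc_hom_eq (gact_product hg hi)) gactM hg (gact_theta1 hi) geltM /x1 -!mulrA.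
by congr (_ * _); rewrite !mulrA [gelt Fc g * _]gmulC.
Qed.

Lemma x1_unit : x1 * x1V = 1.
Proof. by rewrite /x1 /x1V mulrA -[u0 * _ * _]mulrA theta1_unit mulr1. Qed.

Lemma x0_OG : OG (rn ^+ m *: x0).
Proof. by rewrite /x0 gscaleAr; apply: OG_M u0_OG theta0_OG. Qed.

Lemma x0V_OG : OG (rn ^+ m *: x0V).
Proof. by rewrite /x0V gscaleAl; apply: OG_M theta0V_OG u0V_OG. Qed.

Lemma x1V_OG : OG (rn ^+ (m + m) *: x1V).
Proof. by rewrite /x1V gscaleAl; apply: OG_M theta1V_OG u0V_OG. Qed.

Lemma F_h_gen : F_h h a.
Proof. by move=> w t; apply: gen_of_equiv (gact_assoc_hom w). Qed.

Lemma F_h_fixfield b t : F_h h b -> L (b t).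
Proof. by move=> hb w hw; rewrite hb hw mul1g. Qed.

Lemma F_h_int_gen : F_h h a1.
Proof. by move=> w t; apply: gen_of_equiv (gact_x1 w). Qed.

Lemma radX_neq0 k : rn ^+ k != 0.
Proof. by rewrite expf_neq0 // rad_neq0. Qed.

(** u0^-1 (r^m x0) = r^m theta has a coefficient outside the maximal ideal, hence so has r^m x0. The
    value a(t) found here has norm exactly |r|^-m and generates the ideal [I0] below. *)
Lemma gen_max_norm : exists t, a t != 0 /\ O (rn ^+ m * a t)^-1.
Proof.
apply: contrapT => /forallNP no; apply: theta0_not_MG.
have -> : rn ^+ m *: theta0 = u0V * (rn ^+ m *: x0).
  by rewrite /x0 -gscaleAr mulrA [u0V * _]gmulC u0_unit mul1r.
apply: MG_Ml => // t; rewrite grpalgZ.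
have := no t^-1%g; rewrite gen_ofE invgK => /not_andP[/negP|nO].
  by rewrite negbK => /eqP ->; rewrite mulr0; left.
by right.
Qed.

Lemma assoc_hom_agree (w w' : absgal) x : L x -> h w = h w' -> w x = w' x.
Proof.
move=> Lx hww'; have [v [wK vK]] := absgal_inv w'.
have h1 : h (absgal_mul v w) = 1%g.
  apply: assoc_hom_eq; rewrite gelt1 mulr1; apply/ffunP=> t; rewrite gactE /=.
  by rewrite -(gactE w) gact_assoc_hom hww' -gact_assoc_hom gactE wK.
by have := Lx _ h1 => /= e'; rewrite -[LHS]vK e'.
Qed.

Lemma fixfieldD x y : L x -> L y -> L (x + y).
Proof. by move=> hx hy w hw; rewrite rmorphD /= hx // hy. Qed.

Lemma fixfieldM x y : L x -> L y -> L (x * y).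
Proof. by move=> hx hy w hw; rewrite rmorphM /= hx // hy. Qed.

Lemma fixfieldV x : L x -> L x^-1.
Proof. by move=> hx w hw; rewrite fmorphV hx. Qed.

Lemma fixfield_conj x : L x ->
  exists b : gT -> Fc, forall w : absgal, b (h w) = w x.
Proof.
move=> Lx; suff /choice[b hb] t : exists y, forall w : absgal, h w = t -> y = w x.
  by exists b => w; apply: hb.
have [[w hw]|nw] := pselect (exists w : absgal, h w = t).
  by exists (w x) => w' hw'; apply: assoc_hom_agree; rewrite // hw hw'.
by exists 0 => w hw; case: nw; exists w.
Qed.

Definition h_image := [pred t : gT | `[< exists w, h w = t >] ].

Lemma h_imageP t : reflect (exists w, h w = t) (h_image t).
Proof. exact: asboolP. Qed.

(** The trace is a sum over distinct restrictions to F^h; these correspond bijectively to the values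
    of h. *)
Lemma traceE x (b : gT -> Fc) : L x -> (forall w, b (h w) = w x) ->
  traceLF iota L x = \sum_(t | h_image t) b t.
Proof.
move=> Lx hb.
have /choice[wt hwt] (t : gT) : exists w : absgal, h_image t -> h w = t.
  case: (h_imageP t) => [[w hw]|nh]; first by exists w.
  by exists absgal1.
pose r := [seq gal_restr L (wt t) | t <- enum h_image].
have rE : range (gal_restr (iota := iota) L) = [set` r].
  apply/seteqP; split=> [_ [w _ <-]|_ /mapP[t _ ->]]; last by exists (wt t).
  apply/mapP; exists (h w).
    by rewrite mem_enum; apply/h_imageP; exists w.
  apply/funext => y; rewrite /gal_restr /patch; case: ifP => // /set_mem Ly.
  by apply: assoc_hom_agree => //; rewrite hwt //; apply/h_imageP; exists w.
have ur : uniq r.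
  rewrite map_inj_in_uniq ?enum_uniq // => t t'; rewrite !mem_enum => ht ht' e'.
  (* Injectivity: the coefficients of x0 lie in F^h, and their images under [w] determine h(w). *)
  rewrite -(hwt t ht) -(hwt t' ht'); apply: (unit_gelt_inj x0V_unit); rewrite -!gact_assoc_hom.
  apply/ffunP=> g; rewrite !gactE.
  have La : L (x0 g) by rewrite -[g]invgK -gen_ofE; apply: F_h_fixfield F_h_gen.
  by have := congr1 (@^~ (x0 g)) e'; rewrite /gal_restr /patch mem_set.
rewrite /traceLF rE -fsbig_seq // big_map big_enum /=; apply: eq_bigr => t ht.
by rewrite /gal_restr /patch mem_set // -hb hwt.
Qed.

Lemma trace_range x : L x -> exists c, traceLF iota L x = iota c.
Proof.
move=> Lx.
have [b hb] := fixfield_conj Lx.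
rewrite (traceE Lx hb).
apply: (absgal_fixed Fc_char0) => w; rewrite rmorph_sum.
rewrite [RHS](reindex_inj (mulgI (h w))) /=; apply: eq_big => [t|t /h_imageP[v hv]].
  apply/h_imageP/h_imageP=> [[v <-]|[v hv]]; first by exists (absgal_mul w v); rewrite assoc_homM.
  have [w' [wK w'K]] := absgal_inv w; exists (absgal_mul w' v).
  apply: (mulgI (h w)); rewrite -hv -assoc_homM.
  apply: assoc_hom_eq; rewrite -gact_assoc_hom; apply/ffunP=> g; rewrite !gactE /=.
  by rewrite w'K.
by rewrite -hv -assoc_homM !hb.
Qed.

(** Each conjugate of [x] has norm at most |r|^-(2m), so pi times the trace lies in the maximal
    ideal. The trace is in F, where this forces integrality. *)
Lemma trace_integral x : L x -> O (x * rn ^+ (m + m)) -> (iota @` OF absp iota) (traceLF iota L x).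
Proof.
move=> Lx Ox; have [c hc] := trace_range Lx; exists c => //.
apply: (pi_divides_lt pi_unif); rewrite -hc.
have [b hb] := fixfield_conj Lx.
rewrite (traceE Lx hb).
rewrite mulr_suml; apply: maxO_sum => t /h_imageP[w hw].
rewrite -hw hb -(absgal_fix w pi) -rmorphM; apply: absgal_maxO.
by rewrite pi_rad mulrA; apply: maxOMl rad_maxO.
Qed.

(* [x1V] inverts the resolvend of [a1], whence the dual basis formula
   [x = \sum_g tr (x * a1 g) * x1V g]. *)
Lemma inv_differentE x : inv_different absp iota L x <-> L x /\ O (x * rn ^+ (m + m)).
Proof.
split=> [[Lx hx]|[Lx Ox]]; last first.
  split=> // y [Ly Oy]; apply: trace_integral; first exact: fixfieldM.
  by rewrite mulrAC; apply: OFcM.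
split=> //.
have [b hb] := fixfield_conj Lx.
have La1 g := F_h_fixfield g F_h_int_gen.
have trE g : traceLF iota L (x * a1 g) = \sum_(t | h_image t) b t * a1 (t * g)%g.
  apply: traceE => [|w]; first exact: fixfieldM.
  by rewrite hb rmorphM /= F_h_int_gen.
have -> : x = \sum_g traceLF iota L (x * a1 g) * x1V g.
  under eq_bigr => g _ do rewrite trE mulr_suml.
  rewrite exchange_big /=.
  transitivity (\sum_(t | h_image t) b t * (t == 1%g)%:R).
    have h1 : h absgal1 = 1%g.
      by apply: assoc_hom_eq; rewrite gelt1 mulr1; apply/ffunP=> t; rewrite gactE.
    have i1 : h_image 1%g by apply/h_imageP; exists absgal1.
    rewrite (bigD1 1%g) //= big1 ?addr0 => [|t /andP[_ /negbTE ->]]; last by rewrite mulr0.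
    by rewrite eqxx mulr1 -h1 hb.
  apply: eq_bigr => t _; under eq_bigr => g _ do rewrite -mulrA.
  rewrite -mulr_sumr; congr (_ * _).
  (* The sum of a1(t g) x1V(g) over g is the coefficient of x1 x1V = 1 at t^-1. *)
  rewrite -(invg_eq1 t) -grpalg1 -x1_unit grpalgM [LHS](reindex_inj (@invg_inj gT)) /=.
  rewrite [LHS](reindex_inj (mulIg t)) /=; apply: eq_bigr => g _.
  by rewrite gen_ofE invgK mulgK (centsP G_abelian t _ g) ?inE.
rewrite mulr_suml; apply: OFc_sum => g _; rewrite -mulrA; apply: OFcM.
  have [|c hc <-] := hx (a1 g); last exact: hc.
  split=> //; rewrite gen_ofE; apply: (OG_M u0_OG theta1_OG).
by have := x1V_OG g; rewrite grpalgZ mulrC.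
Qed.

Let I0 : set Fc := [set x | L x /\ O (x * rn ^+ m)].

Lemma gen_in_I0 t : I0 (a t).
Proof.
split; first exact: F_h_fixfield F_h_gen.
by have := x0_OG t^-1%g; rewrite grpalgZ mulrC -gen_ofE.
Qed.

Lemma fixfield_iota c : L (iota c).
Proof. by move=> w _; apply: absgal_fix. Qed.

Lemma I0_ideal : is_fractional_ideal absp iota L I0.
Proof.
split.
- by move=> x [].
- by have [t [at0 _]] := gen_max_norm; exists (a t) => //; apply: gen_in_I0.
- move=> x y [Lx Ox] [Ly Oy]; split; first exact: fixfieldD.
  by rewrite mulrDl; apply: OFcD.
- move=> c x [Lc Oc] [Lx Ox]; split; first exact: fixfieldM.
  by rewrite -mulrA; apply: OFcM.
exists (iota pi).
  by split; [split; [exact: fixfield_iota | apply: (pi_OFc pi_unif)] | apply: (pi_neq0 pi_unif)].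
move=> x [Lx Ox]; rewrite mulrC pi_rad exprD.
rewrite (_ : x * _ = (x * rn ^+ m) * (rn ^+ m * rn)); last by ring.
apply: OFcM Ox _.
by apply: OFcM; [apply/OFcX/rad_OFc | apply: rad_OFc].
Qed.

Lemma OFcM_inv x y : O (x * y) -> O y^-1 -> y != 0 -> O x.
Proof. by move=> hxy hy y0; rewrite -(mulfK y0 x); apply: OFcM. Qed.

Lemma I0_square : idealM I0 I0 = inv_different absp iota L.
Proof.
apply/seteqP; split=> x.
  case=> k [f [g [hfg ->]]]; apply/inv_differentE; split.
    elim/big_ind: _ => [|y y'|i _]; [|exact: fixfieldD|].
      by rewrite -(rmorph0 iota); apply: fixfield_iota.
    by have [[Lf _] [Lg _]] := hfg i; apply: fixfieldM.
  rewrite mulr_suml; apply: OFc_sum => i _; have [[_ Of] [_ Og]] := hfg i.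
  by rewrite exprD mulrACA; apply: OFcM.
move=> /inv_differentE[Lx Ox]; have [t [at0 atV]] := gen_max_norm.
have [Lat Oat] := gen_in_I0 t.
(* One product suffices: a(t) has norm exactly |r|^-m, so x / a(t) again satisfies the bound
   defining [I0]. *)
exists 1%N, (fun=> a t), (fun=> x / a t); split; last by rewrite big_ord1 mulrCA divff ?mulr1.
move=> _; split; first by split.
split; first by apply: fixfieldM => //; apply: fixfieldV.
apply: (OFcM_inv (y := rn ^+ m * a t)) => //; last by rewrite mulf_neq0 ?radX_neq0.
suff -> : x / a t * rn ^+ m * (rn ^+ m * a t) = x * rn ^+ (m + m) by [].
by rewrite exprD -[RHS]mulr1 -(divff at0); ring.
Qed.

(** Squares of elements of I lie in the inverse different, and O is closed under roots, so I is
    inside I0. Conversely a(t)^2 is a sum of products f_i g_i of elements of I; as it has the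
    largest possible norm |r|^-(2m), some f_i has norm exactly |r|^-m, and that f_i generates I0. *)
Lemma I0_unique I : is_fractional_ideal absp iota L I ->
  idealM I I = inv_different absp iota L -> I = I0.
Proof.
move=> [IL _ _ ID _] I2.
have prod_in x y : I x -> I y -> inv_different absp iota L (x * y).
  move=> Ix Iy; rewrite -I2; exists 1%N, (fun=> x), (fun=> y).
  by rewrite big_ord1.
have II0 : I `<=` I0.
  move=> x Ix; split; first exact: IL.
  have /inv_differentE[_] := prod_in x x Ix Ix.
  by rewrite exprD mulrACA -expr2 => /OFc_root; apply.
apply/seteqP; split=> // x [Lx Ox].
have [t [at0 atV]] := gen_max_norm; have [Lat Oat] := gen_in_I0 t.
have : idealM I I (a t * a t).
  rewrite I2; apply/inv_differentE; split; first exact: fixfieldM.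
  by rewrite exprD mulrACA; apply: OFcM.
case=> k [f [g [hfg aE]]].
have [i [fi0 fiV]] : exists i, f i != 0 /\ O (f i * rn ^+ m)^-1.
  apply: contrapT => /forallNP no.
  have c0 : rn ^+ m * a t != 0 by rewrite mulf_neq0 ?radX_neq0.
  have hMx : maxO ((rn ^+ m * a t) * (rn ^+ m * a t)).
    rewrite mulrACA mulrC aE mulr_suml; apply: maxO_sum => i _.
    have [If Ig] := hfg i; rewrite mulrACA; apply: maxOMr; last by case: (II0 _ Ig).
    have /not_andP[/negP|nO] := no i; last by right.
    by rewrite negbK => /eqP ->; rewrite mul0r; left.
  have /maxO_prime[] := hMx; move=> /(maxO_unit atV) e'; by rewrite e' eqxx in c0.
have [If _] := hfg i.
have -> : x = x / f i * f i by rewrite divfK.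
apply: ID => //; split; first by apply: fixfieldM => //; apply/fixfieldV/IL.
apply: (OFcM_inv (y := f i * rn ^+ m)) => //; last by rewrite mulf_neq0 ?radX_neq0.
by rewrite mulrA divfK.
Qed.

Lemma sqrt_inv_differentE : sqrt_inv_different absp h = I0.
Proof.
apply: xget_unique; first by split; [exact: I0_ideal | exact: I0_square].
by move=> I [hI I2]; apply: I0_unique.
Qed.

Lemma grpalg_actE (c : grpalg F gT) t :
  grpalg_act iota c a t = \sum_s' iota (c s') * a (t * s')%g.
Proof. by rewrite ffunE. Qed.

(* If [b] is in [A_h] then [y = resolvend b / x0] has coefficients in F with
   [y * rn ^+ (2 * m)] integral; since [2 * m < n] they are integral. *)
Lemma A_h_gen : A_h absp h = OFG_span absp iota a.
Proof.
rewrite /A_h sqrt_inv_differentE; apply/seteqP; split=> [b [Fb Ib]|_ [c Oc <-]]; last first.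
  have Fca : F_h h (grpalg_act iota c a).
    move=> w t; rewrite !grpalg_actE rmorph_sum; apply: eq_bigr => g _.
    by rewrite rmorphM /= absgal_fix F_h_gen mulgA.
  split=> // t; split; first exact: F_h_fixfield.
  rewrite grpalg_actE mulr_suml; apply: OFc_sum => g _; rewrite -mulrA.
  by apply: OFcM; [apply: Oc | case: (gen_in_I0 (t * g)%g)].
pose y := resolvend b * x0V.
have gb (w : absgal) : gact w (resolvend b) = resolvend b * gelt Fc (h w).
  apply/ffunP=> t; rewrite gactE mulr_gelt !resolventE Fb; congr (b _).
  by rewrite invMg invgK.
have gv (w : absgal) : gact w x0V * gelt Fc (h w) = x0V.
  have := gact1 gT w; rewrite -x0_unit gactM gact_assoc_hom => e'.
  have : x0V * (x0 * gelt Fc (h w) * gact w x0V) = x0V * (x0 * x0V) by rewrite e'.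
  rewrite [LHS]mulrA [x0V * (x0 * _)]mulrA x0V_unit mul1r [RHS]mulrA x0V_unit mul1r.
  by rewrite gmulC.
have yF t : exists c, y t = iota c.
  apply: (absgal_fixed Fc_char0) => w; rewrite -(gactE w) /y gactM gb.
  by rewrite -mulrA [gelt Fc _ * _]gmulC gv.
have /choice[c hc] := yF.
have bE : resolvend b = y * x0 by rewrite /y -mulrA x0V_unit mulr1.
exists [ffun t => c t].
  move=> t; rewrite ffunE; apply: (pi_divides_lt pi_unif); rewrite -hc.
  rewrite pi_rad mulrA; apply: maxOMl rad_maxO.
  have hOG : OG (rn ^+ m *: resolvend b).
    by move=> g; rewrite grpalgZ resolventE mulrC; case: (Ib g^-1%g).
  have := OG_M hOG x0V_OG t.
  by rewrite -gscaleAl -gscaleAr scalerA grpalgZ -/y mulrC exprD.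
apply/ffunP=> t; rewrite grpalg_actE.
have := congr1 (fun f : FcG => f t^-1%g) bE; rewrite resolventE invgK grpalgM => ->.
by apply: eq_bigr => g _; rewrite gen_ofE hc invMg ffunE.
Qed.

Lemma gen_generates : [/\ F_h h a, A_h absp h = OFG_span absp iota a
  & gcoset (resolvend a) = gcoset x0].
Proof. by split; [exact: F_h_gen | exact: A_h_gen | rewrite resolvend_gen_of]. Qed.

End Generator.

End Stickelberger.

End LocalFieldIntegers.

Theorem theorem8p6
  (p : nat) (p_prime : prime p)
  (Qp : fieldType) (absp : Qp -> rat) (QpP : is_Qp p absp)
  (F : fieldExtType Qp)
  (Fc : closedFieldType) (iota : {rmorphism F -> Fc})
  (Fc_alg : forall x : Fc, algebraicOver iota x)
  (gT : finGroupType) (G_abelian : abelian [set: gT]%SET) (G_odd : odd #|gT|)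
  (pi : F) (pi_unif : is_uniformizer absp iota (range iota) (iota pi))
  (q : nat) (q_card : is_residue_card absp iota pi q)
  (zeta : nat -> Fc)
  (zeta_prim : forall n, (0 < n)%N -> n.-primitive_root (zeta n))
  (zeta_compat : forall m n, (0 < m)%N -> (0 < n)%N ->
     zeta (m * n)%N ^+ m = zeta n)
  (rad : nat -> Fc)
  (rad_root : forall n, coprime n p -> rad n ^+ n = iota pi)
  (rad_compat : forall m n, coprime (m * n) p -> rad (m * n)%N ^+ m = rad n)
  (sigma : subgal iota (Ft absp iota p pi))
  (sigma_nr : forall x, Fnr absp iota pi x -> sigma x = x)
  (sigma_rad : forall n, coprime n p -> sigma (rad n) = zeta n * rad n)
  (s : gT) (s_ord : (#[s]%g %| q.-1)%N)
  (u : set (grpalg Fc gT)) (u_in : HOFG absp iota u) :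
  let X := gcosetM u (Theta iota zeta (f_ iota pi s)) in
  let h : absgal iota -> gT := assoc_hom X in
  [/\ is_cont_hom h,
      exists2 ht : subgal iota (Ft absp iota p pi) -> gT,
        forall w, h w = ht (res_gal (Ft absp iota p pi) w) & ht sigma = s
    & exists a : {ffun gT -> Fc},
        [/\ F_h h a, A_h absp h = OFG_span absp iota a
          & gcoset (resolvend a) = X]].
Proof.
case: u_in => [[u0 [u0_OG [u0V [u0V_OG u0_unit _]]] uE] u_stab] X h.
have u0_stable (w : absgal iota) : exists g, gal_act w u0 = u0 * gelt Fc g.
  have : gal_act w u0 \in u.
    by rewrite -(u_stab w); apply/mem_set; exists u0; rewrite // uE; apply: gcoset_self.
  by rewrite uE => /set_mem[g _ <-]; exists g.
have XE : X = gcoset (u0 * theta0 zeta rad s).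
  rewrite /X uE (ThetaE QpP Fc_alg p_prime G_abelian G_odd pi_unif q_card zeta_prim
    zeta_compat rad_root s_ord).
  exact: gcosetM_gcoset.
have np := order_coprime QpP Fc_alg p_prime pi_unif q_card s_ord.
rewrite /h XE; split.
- exact: (assoc_hom_cont QpP Fc_alg p_prime G_abelian pi_unif q_card zeta_prim rad_root s_ord
    u0_unit u0_stable).
(* Each embedding of F^t is lifted arbitrarily to Omega_F; by [assoc_hom_tame] the value of h does
   not depend on the lift. *)
- have /choice[lift liftE] (f : subgal iota (Ft absp iota p pi)) :
      exists w : absgal iota, subgal_fun f = gal_restr (Ft absp iota p pi) w.
    by case: f => f fE; exact: fE.
  exists (fun f => assoc_hom (gcoset (u0 * theta0 zeta rad s)) (lift f)).
    move=> w; apply: (assoc_hom_tame QpP Fc_alg p_prime G_abelian pi_unif q_card zeta_prim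
      rad_root s_ord u0_OG u0V_OG u0_unit u0_stable) => x xFt.
    have := congr1 (@^~ x) (liftE (res_gal (Ft absp iota p pi) w)).
    by rewrite /= /gal_restr /patch mem_set.
  have sigmaE x : Ft absp iota p pi x -> lift sigma x = sigma x.
    by move=> xFt; rewrite (liftE sigma) /gal_restr /patch mem_set.
  apply: (assoc_hom_sigma QpP Fc_alg p_prime G_abelian pi_unif q_card zeta_prim rad_root s_ord
    u0_OG u0V_OG u0_unit u0_stable) => [x xnr|].
    by rewrite sigmaE ?sigma_nr //; apply: Fnr_Ft.
  by rewrite sigmaE ?sigma_rad //; apply: (rad_Ft QpP Fc_alg p_prime pi_unif q_card
    zeta_prim rad_root s_ord).
exists (gen_of (u0 * theta0 zeta rad s)).
exact: (gen_generates QpP Fc_alg p_prime G_abelian G_odd pi_unif q_card zeta_prim rad_root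
  s_ord u0_OG u0V_OG u0_unit u0_stable).
Qed.
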